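(* Let $M$ be a smooth connected Riemannian manifold. For every Borel function $w:M\to\mathbb{C}$ and $s\geq 0$ let $$D(w,s):=\sup_{x\in M}\mathbb{E}^x\left[\int_0^s|w(\mathbb{X}_r)|1_{\{r<\zeta\}}\,dr\right]\in[0,\infty].$$ a) For any $w$ in the contractive Dynkin class $\mathcal{D}(M)$, there are $c_j=c_j(w)>0$, $j=1,2$, such that for all $t\geq 0$, $$\sup_{x\in M}\mathbb{E}^x\left[e^{\int_0^t|w(\mathbb{X}_s)|ds}1_{\{t<\zeta\}}\right]\leq c_1e^{tc_2}<\infty.$$ In fact, for every $s>0$ with $D(w,s)<1$ one can pick the constants $$c_1=\frac{1}{1-D(w,s)},\qquad c_2=\frac1s\log\left(\frac{1}{1-D(w,s)}\right).$$ b) For any $w$ in the Kato class $\mathcal{K}(M)$ and any $\delta>1$, there is a $c_\delta=c_\delta(w)>0$ such that for all $t\geq 0$, $$\sup_{x\in M}\mathbb{E}^x\left[e^{\int_0^t|w(\mathbb{X}_s)|ds}1_{\{t<\zeta\}}\right]\leq\delta e^{tc_\delta}<\infty.$$ In fact, for every $s_\delta>0$ with $D(w,s_\delta)<1-1/\delta$ one can pick the constant $$c_\delta=\frac{1}{s_\delta}\log\left(\frac{1}{1-D(w,s_\delta)}\right).$$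
   Context: $M$ is without boundary and possibly noncompact and incomplete; $\mu$ is the Riemannian volume measure; $p(t,x,y)$, $t>0$, $x,y\in M$, is the minimal nonnegative heat kernel of $M$, i.e. the smooth integral kernel of $e^{-tH}$, where $H$ is the Friedrichs realization of $-\frac12\Delta$ in $L^2(M)$ ($\Delta\le 0$ the Laplace-Beltrami operator on $C_c^\infty(M)$). A Borel function $w:M\to\mathbb{C}$ is in the contractive Dynkin class $\mathcal{D}(M)$ if there is $t>0$ with $\sup_{x\in M}\int_0^t\int_Mp(s,x,y)|w(y)|d\mu(y)ds<1$, and in the Kato class $\mathcal{K}(M)$ if $\lim_{t\to0+}\sup_{x\in M}\int_0^t\int_Mp(s,x,y)|w(y)|d\mu(y)ds=0$. Wiener measure: $\widetilde M=M$ if $M$ is compact, and $\widetilde M=M\cup\{\infty_M\}$ is the Alexandrov compactification otherwise. $\Omega_M=C([0,\infty),\widetilde M)$ carries the topology of locally uniform convergence and its Borel $\sigma$-algebra; $\mathbb{X}_t(\gamma)=\gamma(t)$ is the coordinate process. $\widetilde\mu$ is $\mu$ extended by $\widetilde\mu(\{\infty_M\})=1$, and $\widetilde p$ extends $p$ by $\widetilde p(t,x,\infty_M)=1-\int_Mp(t,x,z)d\mu(z)$, $\widetilde p(t,\infty_M,y)=0$ for $x,y\in M$, $\widetilde p(t,\infty_M,\infty_M)=1$ (if $M$ is compact, $\widetilde\mu=\mu$, $\widetilde p=p$). For $x_0\in M$, $\mathbb{P}^{x_0}$ is the unique probability measure on $\Omega_M$ with $$\mathbb{P}^{x_0}\{\mathbb{X}_{t_1}\in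 A_1,\dots,\mathbb{X}_{t_n}\in A_n\}=\int_{A_1}\cdots\int_{A_n}\prod_{j=0}^{n-1}\widetilde p(t_{j+1}-t_j,x_j,x_{j+1})\,d\widetilde\mu(x_n)\cdots d\widetilde\mu(x_1)$$ for all $n$, $0=t_0<t_1<\dots<t_n$ and Borel sets $A_j\subset\widetilde M$. $\mathbb{E}^{x_0}$ is the corresponding expectation, and $\zeta=\inf\{t\geq0:\mathbb{X}_t\notin M\}$ ($\inf\emptyset=\infty$) is the explosion time; the point $\infty_M$ is a trap for $\mathbb{P}^{x_0}$-a.e. path. *)

(* Defs.v *)
From HB Require Import structures.
From mathcomp Require Import all_boot all_order all_algebra.
From mathcomp Require Import all_classical all_reals all_analysis.
From mathcomp Require Import complex.

Set Implicit Arguments.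
Unset Strict Implicit.
Unset Printing Implicit Defensive.

Import Order.TTheory GRing.Theory Num.Theory.
Import numFieldNormedType.Exports.

Local Open Scope classical_set_scope.
Local Open Scope ring_scope.

(** * Smooth functions on open subsets of R^n *)

Section Euclidean.
Variables (R : realType) (n : nat).

Definition pderiv (i : 'I_n) (f : 'rV[R]_n -> R) (u : 'rV[R]_n) : R :=
  'D_('e_i) f u.

Definition pderivs (s : seq 'I_n) (f : 'rV[R]_n -> R) : 'rV[R]_n -> R :=
  foldr pderiv f s.

(** For [U] open this says that [f] is C^oo on [U]: all iterated partial
    derivatives exist and are continuous at every point of [U]. *)
Definition smooth_on (U : set 'rV[R]_n) (f : 'rV[R]_n -> R) : Prop :=
  forall (s : seq 'I_n) (u : 'rV[R]_n), U u ->
    {for u, continuous (pderivs s f)} /\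
    forall i : 'I_n, derivable (pderivs s f) u 'e_i.

End Euclidean.

(** The n-dimensional Lebesgue integral of a nonnegative Borel function, as an
    iterated one-dimensional integral (Tonelli). *)
Fixpoint lebesgue_int (R : realType) (n : nat) :
    ('rV[R]_n -> \bar R) -> \bar R :=
  match n with
  | 0 => fun f => f 0
  | k.+1 => fun f =>
      (\int[lebesgue_measure]_(x in [set: R])
         @lebesgue_int R k (fun v => f (row_mx (x%:M : 'rV[R]_1) v)))%E
  end.

(** * Riemannian manifolds *)

Record chart (R : realType) (n : nat) (T : topologicalType) := Chart {
  chart_dom : set T;
  chart_map : T -> 'rV[R]_n;
  chart_inv : 'rV[R]_n -> T;
  open_chart_dom : open chart_dom;
  open_chart_img : open (chart_map @` chart_dom);
  chart_mapK : forall x, chart_dom x -> chart_inv (chart_map x) = x;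
  continuous_chart_map : {within chart_dom, continuous chart_map};
  continuous_chart_inv :
    {within chart_map @` chart_dom, continuous chart_inv}
}.

Section Transition.
Variables (R : realType) (n : nat) (T : topologicalType).
Implicit Types c d : chart R n T.

Definition chart_img c : set 'rV[R]_n := chart_map c @` chart_dom c.

Definition transition c d (u : 'rV[R]_n) : 'rV[R]_n :=
  chart_map d (chart_inv c u).

(** Row-vector convention: entry (i, k) is d v_k / d u_i. *)
Definition transition_jacobian c d (u : 'rV[R]_n) : 'M[R]_n :=
  \matrix_(i, k) pderiv i (fun v => transition c d v ord0 k) u.

End Transition.

(** A nonempty connected smooth Riemannian manifold of dimension [n], without
    boundary; neither compactness nor completeness is assumed.  The smooth
    structure is given by an atlas (not necessarily maximal), the metric by its
    coordinate matrices (g_ij) in the charts of the atlas; the values of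
    [metric c] off [chart_img c] are irrelevant. *)
Record riemannianManifold (R : realType) (n : nat) := RiemannianManifold {
  carrier :> ptopologicalType;
  manifold_hausdorff : hausdorff_space carrier;
  manifold_second_countable : @second_countable carrier;
  manifold_connected : connected [set: carrier];
  atlas : set (chart R n carrier);
  chart_at : carrier -> chart R n carrier;
  atlas_chart_at : forall x, atlas (chart_at x);
  mem_chart_at : forall x, chart_dom (chart_at x) x;
  smooth_transition : forall c d, atlas c -> atlas d -> forall k : 'I_n,
    smooth_on (chart_map c @` (chart_dom c `&` chart_dom d))
      (fun u => transition c d u ord0 k);
  metric : chart R n carrier -> 'rV[R]_n -> 'M[R]_n;
  smooth_metric : forall c, atlas c -> forall i j : 'I_n,
    smooth_on (chart_img c) (fun u => metric c u i j);
  metric_sym : forall c u, atlas c -> chart_img c u ->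
    (metric c u)^T = metric c u;
  metric_posdef : forall c u, atlas c -> chart_img c u ->
    forall v : 'rV[R]_n, v != 0 -> 0 < (v *m metric c u *m v^T) ord0 ord0;
  metric_transition : forall c d x, atlas c -> atlas d ->
    chart_dom c x -> chart_dom d x ->
    metric c (chart_map c x) =
      transition_jacobian c d (chart_map c x) *m metric d (chart_map d x)
      *m (transition_jacobian c d (chart_map c x))^T
}.

Notation Borel T := (g_sigma_algebraType (@open T)).

Section Geometry.
Variables (R : realType) (n : nat) (M : riemannianManifold R n).
Implicit Types (c : chart R n M) (f g h : M -> R).

Definition volume_density c (u : 'rV[R]_n) : R := Num.sqrt (\det (metric c u)).

Definition riemannian_volume (mu : {measure set (Borel M) -> \bar R}) : Prop :=
  forall c, atlas c -> forall A : set (Borel M),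
    measurable A -> A `<=` chart_dom c ->
    mu A = lebesgue_int (fun u =>
      (\1_(chart_map c @` A) u * volume_density c u)%:E).

Definition smooth f : Prop :=
  forall c, atlas c -> smooth_on (chart_img c) (f \o chart_inv c).

Definition test_function f : Prop :=
  smooth f /\ compact (closure [set x | f x != 0]).

(** (det g)^(-1/2) d_i ((det g)^(1/2) g^ij d_j F), in the coordinates of c *)
Definition laplacian_coord c (F : 'rV[R]_n -> R) (u : 'rV[R]_n) : R :=
  (volume_density c u)^-1 *
  \sum_(i < n) pderiv i (fun v => volume_density c v *
     \sum_(j < n) invmx (metric c v) i j * pderiv j F v) u.

Definition laplacian f (x : M) : R :=
  laplacian_coord (chart_at x) (f \o chart_inv (chart_at x))
    (chart_map (chart_at x) x).

(** p(t,x,y) is jointly C^oo on (0,oo) x M x M *)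
Definition smooth_kernel (p : R -> M -> M -> R) : Prop :=
  forall c d, atlas c -> atlas d ->
    smooth_on [set z : 'rV[R]_(1 + (n + n)) |
        [/\ 0 < lsubmx z ord0 ord0,
            chart_img c (lsubmx (rsubmx z)) &
            chart_img d (rsubmx (rsubmx z))]]
      (fun z => p (lsubmx z ord0 ord0) (chart_inv c (lsubmx (rsubmx z)))
                  (chart_inv d (rsubmx (rsubmx z)))).

(** * The Friedrichs realization of -1/2 Delta and the heat kernel

    [L^2(M)] is the space of real square-integrable Borel functions, with
    equality almost everywhere.  Real scalars suffice: -1/2 Delta commutes with
    complex conjugation, so the operator on complex L^2 is the complexification
    of this one and has the same heat kernel. *)

Variable mu : {measure set (Borel M) -> \bar R}.

Definition L2 f : Prop := (f : Borel M -> R) \in Lfun mu 2%:E.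

Definition inner f g : R := \int[mu]_x (f x * g x).

Definition sqnorm f : R := inner f f.

Definition half_laplacian f (x : M) : R := - (2^-1 * laplacian f x).

(** The domain of the closure of the form <f, -1/2 Delta f> on C_c^oo(M). *)
Definition form_domain f : Prop :=
  L2 f /\ exists u : nat -> M -> R,
    [/\ forall k, test_function (u k),
        sqnorm (u k \- f) @[k --> \oo] --> 0 &
        forall e, 0 < e -> exists N : nat, forall k l, (N <= k)%N -> (N <= l)%N ->
          inner (u k \- u l) (half_laplacian (u k \- u l)) < e].

(** [friedrichs f h] means f \in Dom(H) and H f = h, where H is the restriction
    of the adjoint of -1/2 Delta on C_c^oo(M) to the form domain. *)
Definition friedrichs f h : Prop :=
  [/\ form_domain f, L2 h &
      forall phi, test_function phi ->
        inner f (half_laplacian phi) = inner h phi].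

(** [T] is e^{-tH}: the strongly continuous contraction semigroup on L^2(M)
    with generator -H. *)
Definition heat_semigroup (T : R -> (M -> R) -> (M -> R)) : Prop :=
  [/\ forall t f, 0 <= t -> L2 f -> L2 (T t f) /\ sqnorm (T t f) <= sqnorm f,
      forall t a f g, 0 <= t -> L2 f -> L2 g ->
        {ae mu, forall x, T t (fun y => a * f y + g y) x = a * T t f x + T t g x},
      forall f, L2 f ->
        {ae mu, forall x, T 0 f x = f x} /\
        forall s t, 0 <= s -> 0 <= t ->
          {ae mu, forall x, T (s + t) f x = T s (T t f) x},
      forall f, L2 f -> sqnorm (T t f \- f) @[t --> 0^'+] --> 0 &
      forall f h, L2 f -> L2 h ->
        friedrichs f h <->
        sqnorm (fun x => t^-1 * (f x - T t f x) - h x) @[t --> 0^'+] --> 0].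

(** The values of [p] at nonpositive times are irrelevant. *)
Definition minimal_heat_kernel (p : R -> M -> M -> R) : Prop :=
  [/\ forall t x y, 0 < t -> 0 <= p t x y,
      smooth_kernel p &
      exists2 T, heat_semigroup T &
        forall t f, 0 < t -> L2 f ->
          {ae mu, forall x,
             mu.-integrable setT (fun y => (p t x y * f y)%:E) /\
             T t f x = \int[mu]_y (p t x y * f y)}].

End Geometry.

(** * The compactification of M *)

Section Compactification.
Variables (R : realType) (M : ptopologicalType).
Implicit Type mu : {measure set (Borel M) -> \bar R}.

Notation alexandrov := (one_point_compactification M).

(** Here and below, [left] is the case of a compact M. *)
Definition compactified : ptopologicalType :=
  if pselect (compact [set: M]) then M else alexandrov.

Definition embed : M -> compactified :=
  match pselect (compact [set: M]) as b
    return M -> (if b then M else alexandrov : ptopologicalType)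
  with left _ => id | right _ => Some end.

(** [inside (embed x) = Some x], and [inside] of the point at infinity is
    [None]. *)
Definition inside : compactified -> option M :=
  match pselect (compact [set: M]) as b
    return (if b then M else alexandrov : ptopologicalType) -> option M
  with left _ => Some | right _ => id end.

Lemma measurable_Some :
  measurable_fun [set: Borel M] (Some : Borel M -> Borel alexandrov).
Proof.
apply: (@measurability _ _ (Borel M) (Borel alexandrov) setT _
          (@open alexandrov)) => //.
move=> _ [U oU <-]; rewrite setTI; apply: sub_sigma_algebra.
move/continuousP: (@one_point_compactification_some_continuous M) => /(_ U oU).
exact.
Qed.

Definition ext_measure mu : {measure set (Borel compactified) -> \bar R} :=
  match pselect (compact [set: M]) as b
    return {measure set (Borel (if b then M else alexandrov
                                : ptopologicalType)) -> \bar R}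
  with
  | left _ => mu
  | right _ => measure_add
      (measure_function_pushforward__canonical__measure_function_Measure
         mu measurable_Some)
      (dirac (None : Borel alexandrov))
  end.

(** For compact M, where the point at infinity is absent, only the first case
    occurs. *)
Definition ext_kernel mu (p : R -> M -> M -> R) (t : R) (x y : compactified) : R :=
  match inside x, inside y with
  | Some x', Some y' => p t x' y'
  | Some x', None => 1 - \int[mu]_z p t x' z
  | None, Some _ => 0
  | None, None => 1
  end.

End Compactification.

(** * Path space and Wiener measure *)

Section PathSpace.
Variables (R : realType) (M : ptopologicalType).

Definition half_line : Type := set_type (`[0, +oo[%classic : set R).
HB.instance Definition _ := Topological.on half_line.

Lemma max0_half_line (t : R) :
  Num.max 0 t \in (`[0, +oo[%classic : set R).
Proof. by rewrite inE /= in_itv /= le_max lexx. Qed.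

(** [time t] is only ever used for [t >= 0], where it is [t] itself. *)
Definition time (t : R) : half_line :=
  exist _ (Num.max 0 t) (max0_half_line t).

Definition path_space : Type := continuousType half_line (compactified M).
HB.instance Definition _ := Choice.on path_space.

(** The compact-open topology, i.e. that of locally uniform convergence. *)
HB.instance Definition _ := Topological.copy path_space
  (initial_topology
    (fun g : path_space => (g : half_line -> _) :
       {compact-open, half_line -> compactified M})).

Lemma continuous_point :
  continuous (cst point : half_line -> compactified M).
Proof. by move=> x; apply: cst_continuous. Qed.

Definition constant_path : path_space :=
  HB.pack_for (continuousType half_line (compactified M))
    (cst point : half_line -> compactified M)
    (isContinuous.Build half_line (compactified M) (cst point)
       continuous_point).
HB.instance Definition _ := isPointed.Build path_space constant_path.

Definition coord_process (t : R) (g : path_space) : compactified M := g (time t).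

Definition explosion_time (g : path_space) : \bar R :=
  ereal_inf [set t%:E | t in [set t : R | 0 <= t /\ inside (coord_process t g) = None]].

End PathSpace.

Section Wiener.
Variables (R : realType) (M : ptopologicalType).
Variables (mu : {measure set (Borel M) -> \bar R}) (p : R -> M -> M -> R).

Notation Omega := (path_space R M).
Notation X := (compactified M).

(** For l = [:: (t_1, A_1); ...; (t_n, A_n)], [fdd 1 0 x_0 l] unfolds to
    \int_(A_1) ... \int_(A_n) \prod_(0 <= j < n) p~(t_(j+1) - t_j, x_j, x_(j+1)),
    with the leftmost integral over x_1 and t_0 = 0; [a] accumulates the
    product. *)
Fixpoint fdd (a t : R) (x : X) (l : seq (R * set (Borel X))) : \bar R :=
  match l with
  | [::] => a%:E
  | (t', A) :: l' =>
      (\int[ext_measure mu]_(y in A)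
         fdd (a * ext_kernel mu p (t' - t) x y) t' y l')%E
  end.

Definition wiener_measure (x0 : M) (P : probability (Borel Omega) R) : Prop :=
  forall l : seq (R * set (Borel X)),
    path <%R 0 [seq tA.1 | tA <- l] ->
    (forall tA, tA \in l -> measurable tA.2) ->
    P (\big[setI/setT]_(tA <- l) (coord_process tA.1 @^-1` tA.2)) =
    fdd 1 0 (embed x0) l.

(** Borel functions M -> C; the type cast selects the topology of R[i] as a
    numeric field. *)
Definition borel_complex (w : M -> R[i]) : Prop :=
  forall U : set (R[i] : numFieldType), open U ->
    measurable (w @^-1` U : set (Borel M)).

Definition potential (w : M -> R[i]) (t : R) : \bar R :=
  ereal_sup (range (fun x : M =>
    \int[lebesgue_measure]_(s in `]0%R, t])
      \int[mu]_y (p s x y * ComplexField.Normc.normc (w y))%:E))%E.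

Definition contractive_dynkin (w : M -> R[i]) : Prop :=
  borel_complex w /\ exists2 t, 0 < t & (potential w t < 1)%E.

Definition kato (w : M -> R[i]) : Prop :=
  borel_complex w /\ (potential w t @[t --> 0^'+] --> 0)%E.

(** |w(y)|, set to 0 at the point at infinity; that value plays no role, since
    paths stay in M before the explosion time. *)
Definition absw (w : M -> R[i]) (y : X) : R :=
  if inside y is Some z then ComplexField.Normc.normc (w z) else 0.

Definition alive (t : R) (g : Omega) : R := (t%:E < explosion_time g)%E%:R.

Variable P : M -> probability (Borel Omega) R.

Definition D (w : M -> R[i]) (s : R) : \bar R :=
  ereal_sup (range (fun x : M =>
    \int[P x]_g \int[lebesgue_measure]_(r in `[0%R, s])
       (absw w (coord_process r g) * alive r g)%:E))%E.

Definition sup_exp_moment (w : M -> R[i]) (t : R) : \bar R :=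
  ereal_sup (range (fun x : M =>
    \int[P x]_g
      (expeR (\int[lebesgue_measure]_(s in `[0%R, t]) (absw w (coord_process s g))%:E)
       * (alive t g)%:E)))%E.

End Wiener.

(* Main.v *)
Require Import Defs.
From HB Require Import structures.
From mathcomp Require Import all_boot all_order all_algebra finmap.
From mathcomp Require Import all_classical all_reals all_analysis.
From mathcomp Require Import measurable_realfun giry complex ring lra.

Set Implicit Arguments.
Unset Strict Implicit.
Unset Printing Implicit Defensive.

Import Order.TTheory GRing.Theory Num.Theory.
Import numFieldNormedType.Exports.

Local Open Scope classical_set_scope.
Local Open Scope ring_scope.

(** The bound is Khas'minskii's lemma for the Brownian motion killed at its
    explosion time.

    Put f = |w| and let A(a,b) be the integral over ]a,b] of f(X_r) 1_{r<zeta}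
    (called [occupation]). On the event t < zeta the exponent in the theorem
    equals A(0,t), so it is enough to bound sup_x E^x[e^{A(0,t)}], while D(w,s)
    = sup_x E^x[A(0,s)].

    Take first f <= N and d = D(w,s) < 1, and let V = sup_x E^x[e^{A(0,s)}],
    which is at most e^{Ns} and at least 1. Cut [0,s] into steps of length h.
    For a step [a,r], the convexity bound e^{u+v} <= e^v + e^c u e^v, valid for
    0 <= u <= c, with u = A(a,r) and v = A(r,s), and the Markov property at time
    r, which bounds the conditional expectation of e^v by V, show that
    prepending the step to the interval [r,s] increases E^x[e^{A(.,s)}] by at
    most e^{Nh} V E^x[A(a,r)]. Summing over the steps gives V <= 1 + e^{Nh} V d
    ([exp_occupation_le]), and h -> 0 gives V <= 1/(1-d)
    ([khasminskii_bounded]); the finiteness of V is what allows the last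
    division. The Markov property at the multiples of s then gives the power
    K^{n+1} of K = 1/(1-d) for n s <= t < (n+1) s, which is at most K e^{(t/s)
    log K} ([khasminskii_growth]). Truncation of f and monotone convergence
    remove the boundedness ([khasminskii]). This is the explicit bound in the
    Dynkin class; the one in the Kato class follows because D < 1 - 1/delta says
    that 1/(1-D) < delta, and the existence of constants follows because D(w,s)
    is at most the heat potential of |w| up to time s ([D_le_potential]).

    The Markov property at a fixed time b has to be extracted from the
    finite-dimensional distributions. A path stays in M on [0,t] if and only if
    t < zeta, because M is open in its compactification, so 1_{b+r<zeta} =
    1_{b<zeta} (1_{r<zeta} o theta_b) for every path ([alive_shift]); hence,
    path by path, A(b,b+u) is 1_{b<zeta} times A(0,u) of the shifted path. All
    events are therefore taken in the sigma-algebra generated by the events X_t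
    in B with t > 0 and B a Borel subset of M itself. That zeta and A are
    measurable for it uses compact exhaustions of open sets and the continuity
    of paths ([measurable_stays]). Cylinders based on such events have iterated
    integrals of p as probabilities ([law_cylinder]), and they generate the
    sigma-algebra, so the Markov property holds for the pair formed by the path
    stopped at b and the path shifted by b ([markov_property]) as soon as it
    holds for cylinders, where it is the splitting of an iterated integral.

    Measurability of the iterated integrals in the starting point comes from
    lower semicontinuity: x |-> \int p(t,x,y) h(y) dmu(y) is lower
    semicontinuous by Fatou's lemma, since p is continuous
    ([measurable_lsc_integral]). *)

(** * The one-point compactification and its Borel sets *)

Section CompactifiedSpace.
Variable M : ptopologicalType.
Notation X := (compactified M).
Notation emb := (@embed M).

Lemma inside_embed (x : M) : inside (embed x) = Some x.
Proof. by rewrite /inside /embed /compactified; case: pselect. Qed.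

Lemma inside_Some (y : X) (z : M) : inside y = Some z -> y = embed z.
Proof.
rewrite /inside /embed; move: y; rewrite /compactified.
by case: pselect => [? y [->]|? y ->].
Qed.

Lemma embed_inj : injective emb.
Proof. by move=> x y /(congr1 (@inside M)); rewrite !inside_embed => -[]. Qed.

Lemma inside_NoneP (y : X) : inside y = None <-> ~ range emb y.
Proof.
split=> [yN [z _ zy]|]; first by rewrite -zy inside_embed in yN.
by case E : inside => [z|//] []; exists z => //; rewrite (inside_Some E).
Qed.

Lemma embed_imageP (B : set M) (y : X) :
  (emb @` B) y <-> exists2 z, inside y = Some z & B z.
Proof.
split=> [[z Bz <-]|[z /inside_Some -> Bz]]; last by exists z.
by exists z; rewrite ?inside_embed.
Qed.

Lemma embed_imageI (A B : set M) :
  emb @` (A `&` B) = (emb @` A `&` emb @` B) :> set X.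
Proof.
apply/seteqP; split=> [_ [z [Az Bz] <-]|_ [[z Az <-] [z' Bz' /embed_inj zz']]].
  by split; exists z.
by exists z => //; split=> //; rewrite -zz'.
Qed.

Lemma embed_open (U : set M) : open U -> open (emb @` U : set X).
Proof.
rewrite /embed /compactified; case: pselect => c oU.
  by rewrite image_id.
exact: one_point_compactification_open_some.
Qed.

Lemma embed_compact_closed (K : set M) : hausdorff_space M ->
  compact K -> closed (emb @` K : set X).
Proof.
move=> hM cK; have := compact_closed hM cK.
rewrite /embed /compactified; case: pselect => c clK; first by rewrite image_id.
rewrite -openC openE /= => -[x|] xK.
  rewrite /interior /=.
  have : nbhs x (~` K).
    by apply: open_nbhs_nbhs; split; [rewrite openC|move=> Kx; apply: xK; exists x].
  by apply: filterS => z zK [z' Kz' [zz']]; apply: zK; rewrite -zz'.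
exists K => // y [[z /= Kz <-] [z' Kz' [zz]]|-> [z' _]] //.
by apply: Kz; rewrite -zz.
Qed.

(** The sets with Borel image form a sigma-algebra, complements being taken
    inside the open set M, and it contains the open sets. *)
Lemma measurable_embed_image (B : set (Borel M)) :
  measurable B -> measurable (emb @` B : set (Borel X)).
Proof.
move=> mB.
suff : (@measurable _ (Borel M)) `<=`
  [set B : set (Borel M) | measurable (emb @` B : set (Borel X))].
  by apply.
apply: smallest_sub; last first.
  by move=> U oU; apply: sub_sigma_algebra; exact: embed_open.
have mT : measurable (range emb : set (Borel X)).
  by apply: sub_sigma_algebra; apply: embed_open; exact: openT.
split => /=.
- by rewrite image_set0.
- move=> A mA.
  rewrite (_ : _ @` _ = range emb `\` emb @` A); first exact: measurableD.
  apply/seteqP; split=> [_ [z [_ Az] <-]|_ [[z _ <-] Az]].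
    by split; [exists z|move=> [z' Az' /embed_inj zz]; apply: Az; rewrite -zz].
  by exists z => //; split=> // Az'; apply: Az; exists z.
- by move=> F mF; rewrite image_bigcup; exact: bigcup_measurable.
Qed.

Definition extend T (a : T) (f : M -> T) (y : X) : T :=
  if inside y is Some z then f z else a.

Lemma extend_embed T (a : T) f z : extend a f (embed z) = f z.
Proof. by rewrite /extend inside_embed. Qed.

Lemma measurable_extend d (T : measurableType d) (a : T) (f : Borel M -> T) :
  measurable_fun setT f -> measurable_fun setT (extend a f : Borel X -> T).
Proof.
move=> mf _ B mB; rewrite setTI.
have mT : measurable (range emb : set (Borel X)).
  by apply: sub_sigma_algebra; apply: embed_open; exact: openT.
have mfB : measurable (f @^-1` B) by rewrite -[_ @^-1` _]setTI; exact: mf.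
rewrite (_ : _ @^-1` _ = emb @` (f @^-1` B) `|` (~` range emb `&` [set _ | B a])).
  apply: measurableU; first exact: measurable_embed_image.
  have [Ba|nBa] := pselect (B a).
    rewrite (_ : [set _ | B a] = setT) ?setIT; first exact: measurableC.
    by apply/seteqP; split.
  rewrite (_ : [set _ | B a] = set0) ?setI0; first exact: measurable0.
  by apply/seteqP; split.
apply/seteqP; split=> y.
  rewrite /extend /=; case E : inside => [z|] By.
    by left; apply/embed_imageP; exists z.
  by right; split=> //; apply/inside_NoneP.
case=> [[z fz <-]|[/inside_NoneP yN Ba]]; first by rewrite /= extend_embed.
by rewrite /= /extend yN.
Qed.

(** The extended measure charges the point at infinity, but integrals over
    subsets of M do not see it.  Only the restriction of h to M is assumed
    measurable: h is replaced by its extension by 0. *)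
Lemma integral_ext_measure (R : realType) (mu : {measure set (Borel M) -> \bar R})
    (B : set (Borel M)) (h : X -> \bar R) :
  measurable B -> (forall y, 0 <= h y)%E -> measurable_fun setT (h \o emb : Borel M -> \bar R) ->
  (\int[ext_measure mu]_(y in emb @` B) h y = \int[mu]_(z in B) h (embed z))%E.
Proof.
move=> mB h0 mh.
have mBe := measurable_embed_image mB.
pose h' : Borel X -> \bar R := extend 0%E (h \o emb).
have mh' : measurable_fun setT h' by exact: measurable_extend.
have h'0 y : (0 <= h' y)%E by rewrite /h' /extend; case: inside => //= z; exact: h0.
transitivity (\int[ext_measure mu]_(y in emb @` B) h' y)%E.
  by apply: eq_integral => y /set_mem [z _ <-]; rewrite /h' extend_embed.
have -> : (\int[mu]_(z in B) h (embed z) = \int[mu]_(z in B) h' (embed z))%E.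
  by apply: eq_integral => z _; rewrite /h' extend_embed.
clearbody h'; move: h' mBe mh' h'0 => {h h0 mh}.
rewrite /ext_measure /embed /compactified.
case: pselect => c h mBe mh h0; first by rewrite image_id.
rewrite ge0_integral_measure_add//; last exact: measurable_funTS.
rewrite ge0_integral_pushforward//; [|exact: measurable_Some|exact: measurable_funTS].
rewrite integral_dirac//; last exact: measurable_funTS.
rewrite diracE memNset/=; last by case.
rewrite mul0e adde0; congr integral; apply/seteqP; split=> z /=.
  by move=> [z' Bz' [<-]].
by move=> Bz; exists z.
Qed.

End CompactifiedSpace.

(** * Continuous paths *)

Section PathSpaceTopology.
Variables (R : realType) (M : ptopologicalType).
Notation X := (compactified M).
Notation Omega := (path_space R M).

Lemma continuous_time : continuous (@time R).
Proof.
apply/continuousP => _ [U oU <-].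
have cm : continuous (fun t : R => Num.max 0 t).
  by move=> t; apply: continuous_max; [exact: cvg_cst|exact: cvg_id].
by move/continuousP : cm => /(_ _ oU).
Qed.

Lemma coord_process_continuous (g : Omega) :
  continuous (fun t : R => coord_process t g).
Proof.
by move=> t; apply: continuous_comp; [exact: continuous_time|exact: cts_fun].
Qed.

Lemma timeK (t : R) : 0 <= t -> set_val (time t) = t.
Proof. by move=> t0; exact: (max_idPr t0). Qed.

Lemma continuous_reparam (f : R -> R) (g : Omega) : continuous f ->
  continuous (fun h : half_line R => coord_process (f (set_val h)) g).
Proof.
move=> cf h; apply: (@continuous_comp _ _ _ (fun h => f (set_val h))
  (fun t => coord_process t g)); last exact: coord_process_continuous.
apply: continuous_comp; last exact: cf.
exact: initial_continuous.
Qed.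

(** The path t |-> g (f t) for t >= 0.  Negative values of f are read as 0 by the
    coordinate process, so every continuous time change gives a path. *)
Definition reparam (f : R -> R) (cf : continuous f) (g : Omega) : Omega :=
  HB.pack_for (continuousType (half_line R) X)
    (fun h : half_line R => coord_process (f (set_val h)) g)
    (isContinuous.Build (half_line R) X _ (@continuous_reparam f g cf)).

Lemma coord_reparam f (cf : continuous f) (t : R) (g : Omega) : 0 <= t ->
  coord_process t (reparam cf g) = coord_process (f t) g.
Proof. by move=> t0; rewrite /coord_process [LHS]/= timeK. Qed.

(** Evaluation at a time is continuous for the compact-open topology, because
    a point of the half-line is a compact set. *)
Lemma measurable_coord (t : R) :
  measurable_fun setT (coord_process t : Borel Omega -> Borel X).
Proof.
apply: (@measurability _ _ (Borel Omega) (Borel X) setT _ (@open X)) => //.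
move=> _ [U oU <-]; rewrite setTI; apply: sub_sigma_algebra.
have ct : compact [set time t] by exact: compact_set1.
exists [set f | f @` [set time t] `<=` U]; first exact: (compact_open_open ct oU).
apply/seteqP; split=> g /=.
  by apply; exists (time t).
by move=> gU _ [_ -> <-].
Qed.

End PathSpaceTopology.

(** * Events seen inside M at positive times *)

Section Cylinders.
Variables (R : realType) (M : ptopologicalType).
Notation X := (compactified M).
Notation emb := (@embed M).
Notation Omega := (path_space R M).

Definition visits (t : R) (B : set M) : set Omega :=
  [set g | (emb @` B) (coord_process t g)].

(** The events X_t in B with B inside M and t > 0.  Their probabilities involve
    only the kernel p itself, not its extension to the point at infinity. *)
Definition coord_events : set (set Omega) :=
  [set C | exists t B, [/\ 0 < t, measurable (B : set (Borel M)) & C = visits t B]].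

Notation Paths := (g_sigma_algebraType coord_events).

Lemma measurable_visits (t : R) (B : set (Borel M)) :
  0 < t -> measurable B -> measurable (visits t B : set Paths).
Proof. by move=> t0 mB; apply: sub_sigma_algebra; exists t, B. Qed.

Lemma borel_visits (t : R) (B : set (Borel M)) :
  measurable B -> measurable (visits t B : set (Borel Omega)).
Proof.
move=> mB; have := @measurable_coord R M t measurableT _ (measurable_embed_image mB).
by rewrite setTI.
Qed.

Lemma measurable_coarsen : measurable_fun setT (id : Borel Omega -> Paths).
Proof.
apply: (@measurability _ _ (Borel Omega) Paths setT _ coord_events) => //.
by move=> _ [_ [t [B [t0 mB ->]]] <-]; rewrite setTI; exact: borel_visits.
Qed.

Definition stays (U : set M) (a b : R) : set Omega :=
  [set g | forall s, a <= s <= b -> (emb @` U) (coord_process s g)].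

(** Survival at time t means that the path is still in M at time t as well: M is
    open, so the path stays in M a little longer and the infimum defining zeta
    is larger than t. *)
Lemma alive_stays (t : R) (g : Omega) : 0 <= t ->
  (t%:E < explosion_time g)%E <-> stays setT 0 t g.
Proof.
move=> t0; split=> [tz s /andP[s0 st]|gst].
  apply: contrapT => /inside_NoneP sN.
  have : (explosion_time g <= s%:E)%E by apply: ereal_inf_lbound; exists s.
  by move=> /(lt_le_trans tz); rewrite lte_fin ltNge st.
have [e e0 He] : exists2 e : R, 0 < e &
    forall s, `|s - t| < e -> range emb (coord_process s g).
  have oM : open (range emb : set X) by apply: embed_open; exact: openT.
  have /nbhs_ballP[e e0 He] : nbhs t ((fun s => coord_process s g) @^-1` range emb).
    apply: coord_process_continuous; apply: open_nbhs_nbhs; split=> //.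
    by apply: gst; rewrite t0 lexx.
  by exists e => // s st; apply: He; rewrite /ball /= distrC.
apply: (@lt_le_trans _ _ (t + e)%:E); first by rewrite lte_fin ltrDl.
apply: le_ereal_inf_tmp => _ [s [s0 /inside_NoneP sN] <-]; rewrite lee_fin leNgt.
apply/negP => ste; apply: sN.
have [st|ts] := leP s t; first by apply: gst; rewrite s0.
by apply: He; rewrite ger0_norm ?subr_ge0 1?ltW// ltrBlDl.
Qed.

(** By the strict inequality r < zeta there is a rational time between r and
    zeta; this makes survival a countable union of events [stays]. *)
Lemma alive_approx (r : R) (g : Omega) : 0 <= r ->
  (r%:E < explosion_time g)%E <-> exists q : rat, r < ratr q /\ stays setT 0 (ratr q) g.
Proof.
move=> r0; split=> [rz|[q [rq gq]]]; last first.
  apply/alive_stays => // s /andP[s0 sr]; apply: gq; rewrite s0/=.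
  exact: (le_trans sr (ltW rq)).
have [t rt tz] : exists2 t : R, r < t & (t%:E < explosion_time g)%E.
  move: rz; case: (explosion_time g) => [z| |]//; rewrite ?lte_fin => rz.
    by exists ((r + z) / 2); rewrite ?lte_fin midf_lt.
  by exists (r + 1); rewrite ?ltrDl ?ltry.
have [q] := rat_in_itvoo rt; rewrite in_itv /= => /andP[rq qt].
exists q; split => //; apply/alive_stays; first by rewrite (le_trans r0)// ltW.
by apply: lt_trans tz; rewrite lte_fin.
Qed.

(** U is the increasing union of open sets V n with compact sets K n between V n
    and U.  Every open subset of a locally compact, second countable Hausdorff
    space has this property; it is stated as a property so that the theory of
    paths applies to a general space M. *)
Definition exhaustible (U : set M) : Prop :=
  exists V K : nat -> set M,
    [/\ forall n, open (V n), nondecreasing_seq V, forall n, compact (K n),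
        forall n, V n `<=` K n & forall n, K n `<=` U] /\ U `<=` \bigcup_n V n.

Hypothesis hM : hausdorff_space M.
Hypothesis exM : forall U : set M, open U -> exhaustible U.

Lemma compact_borel (K : set (Borel M)) : compact (K : set M) -> measurable K.
Proof.
move=> cK; rewrite -(setCK K); apply: measurableC; apply: sub_sigma_algebra.
by rewrite /= openC; exact: compact_closed.
Qed.

(** The path stays in U on [a,b] if and only if, for some n, it is in K n at all
    rational times of ]a,b[.  If it stays in U then by compactness of [a,b] one V n
    contains its trace; conversely K n is closed in the compactification, so by
    continuity the path is in K n on all of [a,b].  Only times q > a >= 0 occur,
    as required of the generating events. *)
Lemma measurable_stays (U : set M) (a b : R) : open U -> 0 <= a -> a < b ->
  measurable (stays U a b : set Paths).
Proof.
move=> oU a0 ab; have [V [K [[oV ndV cK VK KU] UV]]] := exM oU.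
rewrite (_ : stays U a b = \bigcup_n \bigcap_(q in [set q : rat | a < ratr q < b])
    visits (ratr q) (K n)).
  apply: bigcupT_measurable => n.
  rewrite -[X in measurable X]setCK setC_bigcap; apply: measurableC.
  rewrite bigcup_mkcond; apply: bigcupT_measurable_rat => q.
  case: ifPn; rewrite ?inE// => /andP[aq _]; apply: measurableC.
  by apply: measurable_visits; [exact: le_lt_trans aq|exact: compact_borel].
apply/seteqP; split=> g /=.
  move=> gU.
  have cab : compact (`[a, b]%classic : set R) by exact: segment_compact.
  (* The open sets V n increase, so a cover of the compact interval by their
     preimages reduces to a single n: near-covering compactness along \oo. *)
  move/compact_near_coveringP : cab => /(_ nat \oo
    (fun n s => (emb @` V n) (coord_process s g)) _) [].
    move=> s; rewrite /= in_itv /= => sab.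
    have [z Uz zs] := gU s sab; have [n _ Vz] := UV z Uz.
    have : nbhs s ((fun s' => coord_process s' g) @^-1` (emb @` V n)).
      apply: coord_process_continuous; apply: open_nbhs_nbhs; split.
        exact: embed_open.
      by exists z.
    move=> Ns.
    exists ((fun s' => coord_process s' g) @^-1` (emb @` V n), [set m | (n <= m)%N]) => /=.
      by split=> //; exists n.
    move=> [s' m] /= [[z' Vz' <-] nm]; exists z' => //.
    by have /subsetPset := ndV _ _ nm; apply.
  move=> n _ Hn; exists n => // q /= /andP[aq qb].
  have [z Vz zq] : (emb @` V n) (coord_process (ratr q) g).
    by apply: (Hn n (leqnn n)); rewrite /= in_itv /= !ltW.
  by exists z => //; exact: VK.
move=> [n _ gK] s sab; suff [z Kz zs] : (emb @` K n) (coord_process s g).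
  by exists z => //; exact: KU Kz.
(* Otherwise the path avoids K n on a neighbourhood of s, which meets ]a,b[ in a
   rational time, even if s is an endpoint. *)
apply: contrapT => nK.
have oK : open (~` (emb @` K n)).
  by rewrite openC; exact: embed_compact_closed.
have /nbhs_ballP[e /= e0 He] : nbhs s ((fun s => coord_process s g) @^-1` (~` (emb @` K n))).
  by apply: coord_process_continuous; apply: open_nbhs_nbhs.
have : Num.max a (s - e) < Num.min b (s + e).
  move: sab => /andP[as_ sb]; rewrite lt_min !gt_max ab/= (le_lt_trans as_) ?ltrDl//=.
  by rewrite (lt_le_trans _ sb) ?ltrBlDr ?ltrDl//= -addrA ltrDl addr_gt0.
move=> /rat_in_itvoo[q]; rewrite in_itv /= gt_max lt_min => /andP[/andP[aq sq] /andP[qb qs]].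
apply: (He (ratr q)); last by apply: gK; rewrite /= aq.
by rewrite /ball /= ltr_norml ltrBrDl ltrBlDl addrC; apply/andP; split; lra.
Qed.

End Cylinders.

(** * The occupation integral up to explosion *)

Section KilledFunctional.
Variables (R : realType) (M : ptopologicalType).
Notation emb := (@embed M).
Notation Omega := (path_space R M).
Notation Paths := (g_sigma_algebraType (@coord_events R M)).
Notation RR := (measurableTypeR R).

Hypothesis hM : hausdorff_space M.
Hypothesis exM : forall U : set M, open U -> exhaustible U.

(** Joint measurability in time and path.  For open B, continuity of paths turns
    X_r in B into the path staying in B on a rational interval around r; the
    general case follows as the sets B with this property form a sigma-algebra. *)
Lemma measurable_visits_time (B : set (Borel M)) : measurable B ->
  measurable ([set rg | 0 < rg.1 /\ visits rg.1 B rg.2] : set (RR * Paths)).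
Proof.
pose G (B : set M) := [set rg | 0 < rg.1 /\ visits rg.1 B rg.2] : set (RR * Paths).
have openG (U : set M) : open U -> measurable (G U).
  move=> oU; rewrite (_ : G U = \bigcup_(a : rat) \bigcup_(b : rat)
     (if (0 < ratr a :> R) && (ratr a < ratr b :> R) then
       `]ratr a, ratr b[%classic `*` stays U (ratr a) (ratr b) else set0)).
    apply: bigcupT_measurable_rat => a; apply: bigcupT_measurable_rat => b.
    case: ifPn => [/andP[a0 ab]|_]; last exact: measurable0.
    apply: measurableX; first exact: measurable_itv.
    by apply: measurable_stays => //; exact: ltW.
  apply/seteqP; split=> [[r g] [/= r0 gr]|[r g] [a _ [b _]]]; last first.
    case: ifPn => // /andP[a0 ab] [/=]; rewrite in_itv /= => /andP[ar rb] gU.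
    by split=> /=; [exact: lt_trans ar|apply: gU; rewrite !ltW].
  have /nbhs_ballP[e /= e0 He] : nbhs r ((fun s => coord_process s g) @^-1` (emb @` U)).
    by apply: coord_process_continuous; apply: open_nbhs_nbhs; split => //; exact: embed_open.
  have /rat_in_itvoo[a] : Num.max 0 (r - e) < r by rewrite gt_max r0 ltrBlDr ltrDl.
  rewrite in_itv /= gt_max => /andP[/andP[a0 ea] ar].
  have /rat_in_itvoo[b] : r < r + e by rewrite ltrDl.
  rewrite in_itv /= => /andP[rb be].
  exists a => //; exists b => //; rewrite a0 (lt_trans ar rb)/=.
  split=> /=; first by rewrite in_itv /= ar rb.
  move=> s /andP[as_ sb]; apply: He; rewrite /ball /= ltr_norml.
  by apply/andP; split; lra.
suff : (@measurable _ (Borel M)) `<=` [set B | measurable (G B)] by apply.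
apply: smallest_sub; last by move=> U oU; exact: openG.
have mT : measurable (G setT) by apply: openG; exact: openT.
split => /=.
- rewrite (_ : G _ = set0); first exact: measurable0.
  by apply/seteqP; split=> // -[r g] [_ []].
- move=> A mA; rewrite (_ : G _ = G setT `\` G A); first exact: measurableD.
  apply/seteqP; split=> -[r g] /=.
    move=> [r0 [z [_ Az] zr]]; split; first by split => //; exists z.
    by case=> _ [z' Az']; rewrite -zr => /embed_inj zz; apply: Az; rewrite -zz.
  move=> [[r0 [z _ zr]] nA]; split=> //; exists z => //; split=> // Az; apply: nA.
  by split=> //; exists z.
- move=> F mF; rewrite (_ : G _ = \bigcup_n G (F n)); first exact: bigcup_measurable.
  apply/seteqP; split=> -[r g] /=.
    by move=> [r0 [z [n _ Fz] zr]]; exists n => //; split=> //; exists z.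
  by move=> [n _ [r0 [z Fz zr]]]; split=> //; exists z => //; exists n.
Qed.

Let posT : set (RR * Paths) := [set rg | 0 < rg.1].

Let mposT : measurable posT.
Proof.
rewrite (_ : posT = `]0, +oo[%classic `*` setT).
  by apply: measurableX; [exact: measurable_itv|exact: measurableT].
by apply/seteqP; split=> -[r g] /=; rewrite in_itv /= andbT // => -[].
Qed.

Lemma measurable_extend_time (f : Borel M -> R) : measurable_fun setT f ->
  measurable_fun posT (fun rg => extend 0 f (coord_process rg.1 rg.2)).
Proof.
move=> mf _ B mB.
have mfB : measurable (f @^-1` B) by rewrite -[_ @^-1` _]setTI; exact: mf.
pose G (B : set (Borel M)) := [set rg | 0 < rg.1 /\ visits rg.1 B rg.2] : set (RR * Paths).
rewrite (_ : _ `&` _ = G (f @^-1` B) `|` ((posT `\` G setT) `&` [set _ | B 0])).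
  apply: measurableU; first exact: measurable_visits_time.
  have mD : measurable (posT `\` G setT).
    by apply: measurableD => //; exact: measurable_visits_time.
  have [Ba|nBa] := pselect (B 0).
    by rewrite (_ : [set _ | B 0] = setT) ?setIT//; apply/seteqP; split.
  rewrite (_ : [set _ | B 0] = set0) ?setI0//.
  by apply/seteqP; split.
apply/seteqP; split=> -[r g].
  move=> [r0] /=; rewrite /extend; case E : inside => [z|] Bz.
    by left; split => //; exists z => //; rewrite (inside_Some E).
  by right; split=> //; split=> // -[_]; apply/inside_NoneP.
case=> [[r0 [z fz zr]]|[[r0 nG] B0]]; split=> //=.
  by rewrite -zr extend_embed.
rewrite /extend; case E : inside => [z|//].
by exfalso; apply: nG; split=> //; exists z => //; rewrite (inside_Some E).
Qed.

Lemma measurable_alive_time :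
  measurable_fun posT (fun rg => alive rg.1 rg.2 : R).
Proof.
pose A : set (RR * Paths) := [set rg | 0 < rg.1 /\ (rg.1%:E < explosion_time rg.2)%E].
have mA : measurable A.
  rewrite (_ : A = \bigcup_(q : rat) (if 0 < ratr q :> R then
     `]0, ratr q[%classic `*` stays setT 0 (ratr q) else set0)).
    apply: bigcupT_measurable_rat => q; case: ifPn => [q0|_]; last exact: measurable0.
    apply: measurableX; first exact: measurable_itv.
    by apply: measurable_stays => //; exact: openT.
  apply/seteqP; split=> [[r g] [/= r0 /(alive_approx _ (ltW r0))[q [rq gq]]]|[r g] [q _]].
    by exists q => //; rewrite (lt_trans r0 rq); split=> //=; rewrite in_itv /= r0.
  case: ifPn => // q0 [/=]; rewrite in_itv /= => /andP[r0 rq] gq; split=> //=.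
  by apply/alive_approx; [exact: ltW|exists q].
apply: (eq_measurable_fun (\1_A : RR * Paths -> R)).
  move=> [r g] /set_mem /= r0; rewrite /alive indicE; congr ((nat_of_bool _)%:R).
  apply/idP/idP => [/set_mem[]//|rz]; exact/mem_set.
exact: measurable_indic.
Qed.

(** f(X_r) 1_{r<zeta}. *)
Definition killed (f : M -> R) (r : R) (g : Omega) : R :=
  extend 0 f (coord_process r g) * alive r g.

Lemma alive_ge0 r (g : Omega) : 0 <= alive r g. Proof. exact: ler0n. Qed.

Lemma extend_ge0 (f : M -> R) y : (forall x, 0 <= f x) -> 0 <= extend 0 f y.
Proof. by move=> f0; rewrite /extend; case: inside. Qed.

Lemma killed_ge0 f r g : (forall x, 0 <= f x) -> 0 <= killed f r g.
Proof. by move=> f0; rewrite mulr_ge0 ?extend_ge0 ?alive_ge0. Qed.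

Lemma measurable_killed (f : Borel M -> R) : measurable_fun setT f ->
  measurable_fun posT (fun rg => killed f rg.1 rg.2).
Proof.
by move=> mf; apply: measurable_funM;
  [exact: measurable_extend_time|exact: measurable_alive_time].
Qed.

Lemma measurable_killed_section (f : Borel M -> R) (g : Omega) (a b : R) : measurable_fun setT f ->
  0 <= a -> measurable_fun (`]a, b]%classic : set RR) (fun r => killed f r g).
Proof.
move=> mf a0; have H := measurable_killed mf.
apply: (@measurable_comp _ _ _ RR (RR * Paths)%type _ posT
  (fun rg => killed f rg.1 rg.2) (`]a, b]%classic : set RR) (fun r => (r, g : Paths))) => //.
  by move=> _ [r + <-]; rewrite /= in_itv /= => /andP[ar _]; exact: le_lt_trans ar.
by apply: measurable_funTS; apply: measurable_fun_pair.
Qed.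

Definition occupation (f : M -> R) (a b : R) (g : Omega) : \bar R :=
  (\int[lebesgue_measure]_(r in `]a, b]) (killed f r g)%:E)%E.

Lemma occupationE (f : Borel M -> R) (s : R) (g : Omega) : measurable_fun setT f ->
  (\int[lebesgue_measure]_(r in `[0%R, s]) (killed f r g)%:E)%E = occupation f 0 s g.
Proof.
move=> mf; rewrite /occupation -integral_itv_obnd_cbnd//.
by apply/measurable_EFinP; exact: measurable_killed_section.
Qed.

Lemma occupation_ge0 f a b g : (forall x, 0 <= f x) -> (0 <= occupation f a b g)%E.
Proof. by move=> f0; apply: integral_ge0 => r _; rewrite lee_fin killed_ge0. Qed.

Let killed_patch (f : M -> R) (a b : R) : RR * Paths -> \bar R :=
  (fun rg => (killed f rg.1 rg.2)%:E) \_ (`]a, b] `*` setT).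

Let measurable_killed_patch (f : Borel M -> R) (a b : R) : measurable_fun setT f -> 0 <= a ->
  measurable_fun setT (killed_patch f a b).
Proof.
move=> mf a0; apply/(measurable_restrictT _ _).1.
  by apply: measurableX; [exact: measurable_itv|exact: measurableT].
apply/measurable_EFinP; apply: measurable_funS (measurable_killed mf) => //.
by move=> [r g] [/=]; rewrite in_itv /= => /andP[ar _] _; exact: le_lt_trans ar.
Qed.

Let occupation_patch f a b g :
  occupation f a b g = (\int[lebesgue_measure]_r killed_patch f a b (r, g))%E.
Proof.
rewrite /occupation integral_mkcond; apply: eq_integral => r _.
rewrite /killed_patch !patchE; congr (if _ then _ else _).
by apply/idP/idP => /set_mem H; apply/mem_set => //; case: H.
Qed.

Lemma measurable_occupation (f : Borel M -> R) (a b : R) : measurable_fun setT f ->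
  (forall x, 0 <= f x) -> 0 <= a ->
  measurable_fun setT (occupation f a b : Paths -> \bar R).
Proof.
move=> mf f0 a0; rewrite (_ : occupation f a b =
  (fun g => \int[lebesgue_measure]_r killed_patch f a b (r, g))%E); last first.
  by apply/funext => g; exact: occupation_patch.
apply: (@measurable_fun_fubini_tonelli_G _ _ RR Paths R lebesgue_measure).
  exact: measurable_killed_patch.
by move=> rg; rewrite /killed_patch patchE; case: ifP => // _; rewrite lee_fin killed_ge0.
Qed.

Lemma occupation_fubini (P : {sigma_finite_measure set Paths -> \bar R})
    (f : Borel M -> R) (a b : R) :
  measurable_fun setT f -> (forall x, 0 <= f x) -> 0 <= a ->
  (\int[P]_g occupation f a b g =
   \int[lebesgue_measure]_(r in `]a, b]) \int[P]_g (killed f r g)%:E)%E.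
Proof.
move=> mf f0 a0; under eq_integral do rewrite occupation_patch.
rewrite -(@fubini_tonelli _ _ RR Paths R lebesgue_measure P (killed_patch f a b)); last 2 first.
  exact: measurable_killed_patch.
  by move=> rg; rewrite /killed_patch patchE; case: ifP => // _; rewrite lee_fin killed_ge0.
rewrite [RHS]integral_mkcond; apply: eq_integral => r _.
rewrite patchE; case: ifPn => rab.
  move/set_mem: rab => rab; by apply: eq_integral => g _; rewrite /killed_patch patchE mem_set.
rewrite integral0_eq// => g _; rewrite /killed_patch patchE memNset//.
by case=> /mem_set; rewrite (negPf rab).
Qed.

End KilledFunctional.

(** * Stopped and shifted paths *)

Section Translation.
Variable R : realType.
Notation RR := (measurableTypeR R).

Lemma measurable_shiftR (b : R) : measurable_fun setT (fun r : RR => b + r : RR).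
Proof. by apply: (@measurable_funD _ _ R setT (cst b) id). Qed.

Lemma lebesgue_measure_shift (b : R) (A : set RR) : measurable A ->
  pushforward lebesgue_measure (fun r : RR => b + r : RR) A = lebesgue_measure A.
Proof.
move=> mA; apply/esym/lebesgue_measure_unique => //=.
  exact: measurable_shiftR.
move=> _ _ [[c d]] _ <-; rewrite /pushforward.
rewrite (_ : _ @^-1` _ = `](c - b), (d - b)]%classic); last first.
  by apply/seteqP; split=> r /=; rewrite !in_itv /= ltrBlDl lerBrDl.
by rewrite !lebesgue_measure_itv/= !lte_fin ltrD2r; case: ifP => // _; congr (_%:E); ring.
Qed.

Lemma ge0_integral_shift (b u : R) (h : R -> \bar R) :
  measurable_fun (`]b, b + u]%classic : set RR) h ->
  (forall r, b < r <= b + u -> (0 <= h r)%E) ->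
  (\int[lebesgue_measure]_(r in `]b, (b + u)%R]) h r =
   \int[lebesgue_measure]_(r in `]0%R, u]) h (b + r)%R)%E.
Proof.
move=> mh h0.
have E : (`]0, u]%classic : set RR) = (fun r : RR => b + r : RR) @^-1` `]b, b + u].
  by apply/seteqP; split=> r /=; rewrite !in_itv /= ltrDl lerD2l.
rewrite E -(@ge0_integral_pushforward _ _ _ _ R _ (measurable_shiftR b) lebesgue_measure _ h)//.
  apply: eq_measure_integral => [|? A mA _]; first exact: measurable_shiftR.
  exact/esym/lebesgue_measure_shift.
by move=> r; rewrite inE /= in_itv /=; exact: h0.
Qed.

End Translation.

Section StopShift.
Variables (R : realType) (M : ptopologicalType).
Notation Omega := (path_space R M).
Notation Paths := (g_sigma_algebraType (@coord_events R M)).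
Notation RR := (measurableTypeR R).

Lemma continuous_stop_time (b : R) : continuous (fun t : R => Num.min t b).
Proof. by move=> t; apply: continuous_min; [exact: cvg_id|exact: cvg_cst]. Qed.

Lemma continuous_shift_time (b : R) : continuous (fun t : R => b + t).
Proof. by move=> t; apply: cvgD; [exact: cvg_cst|exact: cvg_id]. Qed.

(** [stop_path b] and [shift_path b] carry the information before and after time
    b.  Working with these two maps replaces the sigma-algebra of the past by
    the functionals of the stopped path. *)
Definition stop_path (b : R) : Omega -> Omega := reparam (@continuous_stop_time b).
Definition shift_path (b : R) : Omega -> Omega := reparam (@continuous_shift_time b).

Lemma coord_stop (b t : R) (g : Omega) : 0 <= t ->
  coord_process t (stop_path b g) = coord_process (Num.min t b) g.
Proof. exact: coord_reparam. Qed.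

Lemma coord_shift (b t : R) (g : Omega) : 0 <= t ->
  coord_process t (shift_path b g) = coord_process (b + t) g.
Proof. exact: coord_reparam. Qed.

Lemma visits_stop (b t : R) (B : set M) : 0 <= t ->
  stop_path b @^-1` visits t B = visits (Num.min t b) B.
Proof. by move=> t0; apply/seteqP; split=> g; rewrite /visits /preimage /mkset coord_stop. Qed.

Lemma visits_shift (b t : R) (B : set M) : 0 <= t ->
  shift_path b @^-1` visits t B = visits (b + t) B.
Proof. by move=> t0; apply/seteqP; split=> g; rewrite /visits /preimage /mkset coord_shift. Qed.

Lemma measurable_stop (b : R) : 0 < b -> measurable_fun setT (stop_path b : Paths -> Paths).
Proof.
move=> b0; apply: (@measurability _ _ Paths Paths setT _ (@coord_events R M)) => //.
move=> _ [_ [t [B [t0 mB ->]]] <-]; rewrite setTI visits_stop ?ltW//.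
by apply: measurable_visits => //; rewrite lt_min t0.
Qed.

Lemma measurable_shift (b : R) : 0 <= b -> measurable_fun setT (shift_path b : Paths -> Paths).
Proof.
move=> b0; apply: (@measurability _ _ Paths Paths setT _ (@coord_events R M)) => //.
move=> _ [_ [t [B [t0 mB ->]]] <-]; rewrite setTI visits_shift ?ltW//.
by apply: measurable_visits => //; rewrite ltr_wpDl.
Qed.

Lemma alive_stop (b r : R) (g : Omega) : 0 <= r <= b -> alive r (stop_path b g) = alive r g :> R.
Proof.
move=> /andP[r0 rb]; rewrite /alive; congr ((nat_of_bool _)%:R).
have E s : 0 <= s <= r -> coord_process s (stop_path b g) = coord_process s g.
  by move=> /andP[s0 sr]; rewrite coord_stop// (min_idPl (le_trans sr rb)).
by apply/idP/idP => /(alive_stays _ r0) H; apply/alive_stays => // s sr;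
  [rewrite -E//|rewrite E//]; exact: H.
Qed.

(** The explosion time is a terminal time: surviving b + r is surviving b and
    then surviving r for the shifted path.  This is a pathwise identity, valid
    also for paths that return from infinity. *)
Lemma alive_shift (b r : R) (g : Omega) : 0 <= b -> 0 <= r ->
  alive (b + r) g = alive b g * alive r (shift_path b g) :> R.
Proof.
move=> b0 r0; rewrite /alive -natrM mulnb; congr ((nat_of_bool _)%:R).
apply/idP/andP => [/(alive_stays _ (addr_ge0 b0 r0)) H|[]].
  split; apply/alive_stays => // s /andP[s0 sb].
    by apply: H; rewrite s0 (le_trans sb)// lerDl.
  by rewrite coord_shift//; apply: H; rewrite addr_ge0//= lerD2l.
move=> /(alive_stays _ b0) H1 /(alive_stays _ r0) H2.
apply/alive_stays; first exact: addr_ge0.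
move=> s /andP[s0 sbr]; have [sb|/ltW bs] := leP s b; first by apply: H1; rewrite s0.
have : 0 <= s - b <= r by rewrite subr_ge0 bs lerBlDl.
by move=> sbr'; have := H2 _ sbr'; rewrite coord_shift ?subr_ge0// addrC subrK.
Qed.

Lemma killed_stop (f : M -> R) (b r : R) (g : Omega) : 0 <= r <= b ->
  killed f r (stop_path b g) = killed f r g.
Proof.
move=> rb; rewrite /killed alive_stop//; move: rb => /andP[r0 rb].
by rewrite coord_stop// (min_idPl rb).
Qed.

Lemma killed_shift (f : M -> R) (b r : R) (g : Omega) : 0 <= b -> 0 <= r ->
  killed f (b + r) g = alive b g * killed f r (shift_path b g).
Proof. by move=> b0 r0; rewrite /killed alive_shift// coord_shift// mulrCA. Qed.

Lemma occupation_stop (f : M -> R) (a c b : R) (g : Omega) : 0 <= a -> c <= b ->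
  occupation f a c (stop_path b g) = occupation f a c g.
Proof.
move=> a0 cb; apply: eq_integral => r; rewrite inE /= in_itv /= => /andP[ar rc].
by rewrite killed_stop// (le_trans a0 (ltW ar)) (le_trans rc).
Qed.

Hypothesis hM : hausdorff_space M.
Hypothesis exM : forall U : set M, open U -> exhaustible U.
Variable f : Borel M -> R.
Hypothesis mf : measurable_fun setT f.
Hypothesis f0 : forall x, 0 <= f x.

Lemma occupation_cat (a b c : R) (g : Omega) : 0 <= a -> a <= b -> b <= c ->
  (occupation f a c g = occupation f a b g + occupation f b c g)%E.
Proof.
move=> a0 ab bc; have E : (`]a, c]%classic : set RR) = `]a, b] `|` `]b, c].
  apply/seteqP; split=> r /=; rewrite !in_itv /=.
    by move=> /andP[ar rc]; have [rb|rb] := leP r b; [left|right]; rewrite ?ar ?rb.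
  by move=> [/andP[ar rb]|/andP[br rc]]; rewrite ?ar ?rc ?andbT/=;
    [exact: le_trans bc|exact: le_lt_trans br].
rewrite /occupation E ge0_integral_setU//=; rewrite -?E.
- by apply/measurable_EFinP; exact: measurable_killed_section.
- by move=> r _; rewrite lee_fin killed_ge0.
- apply/disj_setPLR => r /=; rewrite !in_itv /= => /andP[_ rb].
  by apply/negP; rewrite negb_and -leNgt rb.
Qed.

Lemma occupation_shift (b u : R) (g : Omega) : 0 <= b ->
  (occupation f b (b + u) g = (alive b g)%:E * occupation f 0 u (shift_path b g))%E.
Proof.
move=> b0; rewrite /occupation ge0_integral_shift; last 2 first.
- by apply/measurable_EFinP; exact: measurable_killed_section.
- by move=> r _; rewrite lee_fin killed_ge0.
rewrite -ge0_integralZl_EFin ?alive_ge0//.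
- apply: eq_integral => r; rewrite inE /= in_itv /= => /andP[r0 _].
  by rewrite (killed_shift f g b0 (ltW r0)) EFinM.
- by move=> r _; rewrite lee_fin killed_ge0.
- by apply/measurable_EFinP; exact: measurable_killed_section.
Qed.

End StopShift.

(** * Integrals of nonnegative functions *)

Section FunctionalIntegral.
Local Open Scope ereal_scope.
Context d (T : measurableType d) (R : realType) (m : {measure set T -> \bar R}).
Variable Phi : (T -> \bar R) -> \bar R.
Hypothesis PhiI : forall A, measurable A -> Phi (fun x => (\1_A x)%:E) = m A.
Hypothesis PhiD : forall (a : R) (f g : T -> \bar R), (0 <= a)%R ->
  measurable_fun setT f -> measurable_fun setT g ->
  (forall x, 0 <= f x) -> (forall x, 0 <= g x) ->
  Phi (fun x => a%:E * f x + g x) = a%:E * Phi f + Phi g.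
Hypothesis PhiL : forall h : nat -> T -> \bar R,
  (forall n, measurable_fun setT (h n)) -> (forall n x, 0 <= h n x) ->
  (forall x, nondecreasing_seq (h ^~ x)) ->
  Phi (fun x => limn (h ^~ x)) = limn (fun n => Phi (h n)).

Import HBNNSimple.

Let PhiS (s : seq R) (E : R -> set T) : (forall y, measurable (E y)) ->
  (forall y, y \in s -> (0 <= y)%R) ->
  Phi (fun x => \sum_(y <- s) (y%:E * (\1_(E y) x)%:E)) =
  \int[m]_x (\sum_(y <- s) (y%:E * (\1_(E y) x)%:E)).
Proof.
move=> mE; have mI y : measurable_fun setT (fun x => (\1_(E y) x)%:E : \bar R).
  by apply/measurable_EFinP; exact: measurable_indic.
elim: s => [_|y s IH ys].
  have E0 : (fun x => \sum_(y <- [::]) (y%:E * (\1_(E y) x)%:E)) =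
      (fun x => (\1_(set0 : set T) x)%:E :> \bar R).
    by apply/funext => x; rewrite big_nil indicE in_set0.
  by rewrite E0 PhiI// integral_indic// set0I.
have s0 x : 0 <= \sum_(y <- s) (y%:E * (\1_(E y) x)%:E).
  rewrite big_seq sume_ge0// => z zs; rewrite mule_ge0 ?lee_fin//.
  by apply: ys; rewrite inE zs orbT.
have y0 : (0 <= y)%R by apply: ys; rewrite mem_head.
have mS : measurable_fun setT (fun x => \sum_(y <- s) (y%:E * (\1_(E y) x)%:E)).
  by apply: emeasurable_sum => z; exact: measurable_funeM.
have EC : (fun x => \sum_(z <- y :: s) (z%:E * (\1_(E z) x)%:E)) =
    (fun x => y%:E * (\1_(E y) x)%:E + \sum_(z <- s) (z%:E * (\1_(E z) x)%:E)).
  by apply/funext => x; rewrite big_cons.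
rewrite EC.
rewrite PhiD// ge0_integralD//.
- rewrite ge0_integralZl_EFin// PhiI// integral_indic// setIT IH// => z zs.
  by apply: ys; rewrite inE zs orbT.
- by move=> x _; rewrite mule_ge0 ?lee_fin.
- exact: measurable_funeM.
Qed.

(** A functional on nonnegative measurable functions which is linear, continuous
    along increasing sequences and equal to m on indicators is the integral
    against m.  This transfers identities known for sets to functions without
    repeating the approximation by simple functions. *)
Lemma ge0_functional_integral (f : T -> \bar R) :
  measurable_fun setT f -> (forall x, 0 <= f x) -> Phi f = \int[m]_x f x.
Proof.
move=> mf f0; pose g := nnsfun_approx measurableT mf.
have gE n : Phi (EFin \o g n) = \int[m]_x (g n x)%:E.
  have E x : (g n x)%:E = \sum_(y <- finmap.enum_fset (fset_set (range (g n))))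
      (y%:E * (\1_(g n @^-1` [set y]) x)%:E).
    rewrite fimfunE fsbig_finite//= sumEFin; congr (_%:E).
  rewrite (_ : EFin \o g n = (fun x => \sum_(y <- finmap.enum_fset (fset_set (range (g n))))
      (y%:E * (\1_(g n @^-1` [set y]) x)%:E))); last by apply/funext.
  rewrite PhiS//.
    by apply: eq_integral => x _; rewrite E.
  move=> y ys; have : y \in fset_set (range (g n)) by [].
  by rewrite in_fset_set// inE => -[x _ <-].
have nd x : nondecreasing_seq (fun n => (g n x)%:E).
  by move=> i j ij; rewrite lee_fin; exact/lefP/nd_nnsfun_approx.
have mg n : measurable_fun setT (fun x => (g n x)%:E) by exact/measurable_EFinP.
have -> : f = fun x => limn (fun n => (g n x)%:E).
  by apply/funext => x; apply/esym/cvg_lim => //; exact: cvg_nnsfun_approx.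
rewrite (PhiL (h := fun n x => (g n x)%:E))//.
rewrite monotone_convergence//.
- by congr (limn _); apply/funext => n; exact: gE.
- by move=> n x _; rewrite lee_fin.
- by move=> n x; rewrite lee_fin.
Qed.

End FunctionalIntegral.

Section IntegralLemmas.
Local Open Scope ereal_scope.

(** The integral of a nonnegative function is a supremum over the simple functions
    below it, so monotonicity holds for functions that may fail to be measurable,
    such as the inner integrals in the potential. *)
Lemma ge0_le_integral_pointwise d (T : measurableType d) (R : realType)
    (m : {measure set T -> \bar R}) (A : set T) (f g : T -> \bar R) : (forall x, A x -> 0 <= f x) ->
  (forall x, A x -> f x <= g x) -> \int[m]_(x in A) f x <= \int[m]_(x in A) g x.
Proof.
move=> f0 fg; rewrite ge0_integralE// [leRHS]ge0_integralE; last first.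
  by move=> x Ax; exact: le_trans (f0 x Ax) (fg x Ax).
apply: ge_ereal_sup => _ [h /= hf <-]; apply: ereal_sup_ubound; exists h => //= x.
apply: le_trans (hf x) _; rewrite !patchE; case: ifPn => // /set_mem Ax.
exact: fg.
Qed.

Lemma integral_mrestr d (T : measurableType d) (R : realType) (m : {measure set T -> \bar R})
    (D : set T) (mD : measurable D) (f : T -> \bar R) :
  measurable_fun setT f -> (forall y, 0 <= f y) ->
  \int[mrestr m mD]_y f y = \int[m]_(y in D) f y.
Proof.
move=> mf f0; apply/esym.
apply: (@ge0_functional_integral _ T R (mrestr m mD) (fun f => \int[m]_(y in D) f y)) => //.
- by move=> A mA; rewrite integral_indic.
- move=> a u v a0 mu_ mv u0 v0; rewrite ge0_integralD//.
  + by rewrite ge0_integralZl_EFin//; exact: measurable_funTS.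
  + by move=> y _; rewrite mule_ge0 ?lee_fin.
  + by apply: measurable_funTS; exact: measurable_funeM.
  + exact: measurable_funTS.
- move=> u mu_ u0 nd; rewrite -monotone_convergence//.
  by move=> n; exact: measurable_funTS.
Qed.

End IntegralLemmas.

(** * Lower semicontinuity of kernel integrals *)

Lemma countable_enumeration T (B : set (set T)) : countable B ->
  exists e : nat -> set T, forall b, B b -> exists k, e k = b.
Proof.
move=> /countable_injP[h hi].
exists (fun k => get [set b : set T | B b /\ h b = k]) => b Bb; exists (h b).
have [Bg hg] : [set b' | B b' /\ h b' = h b] (get [set b' | B b' /\ h b' = h b]).
  by apply: getPex; exists b.
by apply: hi => //; apply/mem_set.
Qed.

Section LowerSemicontinuous.
Variables (R : realType) (M : ptopologicalType).
Hypothesis scM : @second_countable M.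

Lemma measurable_continuous (f : M -> R) : continuous f ->
  measurable_fun setT (f : Borel M -> R).
Proof.
move=> /continuousP cf; apply: (measurability _ (RGenOpens.measurableE R)).
move=> _ [_ [a [b ->]] <-]; rewrite setTI; apply: sub_sigma_algebra.
by apply: cf; exact: interval_open.
Qed.

Lemma nbhs_sequence (x : M) : exists U : nat -> set M,
  (forall n, nbhs x (U n)) /\ forall V, nbhs x V -> exists N, forall n, (N <= n)%N -> U n `<=` V.
Proof.
have [B cB [oB nB]] := scM.
have [e Be] := countable_enumeration cB.
pose W n := [set y | forall i, (i <= n)%N -> B (e i) -> e i x -> e i y].
exists W; split.
  elim=> [|n IH].
    have [[Be0 ex0]|ne0] := pselect (B (e 0%N) /\ e 0%N x).
      have : nbhs x (e 0%N) by apply: open_nbhs_nbhs; split => //; exact: oB.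
      by apply: filterS => y ey i; rewrite leqn0 => /eqP ->.
    by apply: filterE => y i; rewrite leqn0 => /eqP -> B0 e0; case: ne0.
  have [[Ben exn]|nen] := pselect (B (e n.+1) /\ e n.+1 x).
    have : nbhs x (e n.+1) by apply: open_nbhs_nbhs; split => //; exact: oB.
    apply: filterS2 IH => y Wy ey i; rewrite leq_eqVlt => /predU1P[->//|].
    by rewrite ltnS; exact: Wy.
  apply: filterS IH => y Wy i; rewrite leq_eqVlt => /predU1P[-> Bn en|].
    by case: nen.
  by rewrite ltnS; exact: Wy.
move=> V /nB[b [Bb bx] bV]; have [N eN] := Be b Bb.
by exists N => n Nn y Wy; apply: bV; rewrite -eN; apply: Wy; rewrite ?eN.
Qed.

Section Kernel.
Variables (mu : {measure set (Borel M) -> \bar R}) (q : M -> M -> R) (B : set (Borel M)).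
Hypothesis q0 : forall x y, 0 <= q x y.
Hypothesis cq : forall y, continuous (q ^~ y).
Hypothesis mq : forall x, measurable_fun setT (q x : Borel M -> R).
Hypothesis mB : measurable B.

(** The set where the integral exceeds a is open: otherwise some sequence u n
    converging to a point x of it has integrals at most a, and Fatou's lemma
    along u bounds the integral at x by a.  Second countability provides the
    sequence. *)
Let measurable_lsc_integral_fin (h : Borel M -> R) :
  measurable_fun setT h -> (forall y, 0 <= h y) ->
  measurable_fun setT
    ((fun x => \int[mu]_(y in B) ((q x y)%:E * (h y)%:E))%E : Borel M -> \bar R).
Proof.
move=> mh h0; apply: (measurability _ (ErealGenOInfty.measurableE R)).
move=> _ [_ [a ->] <-]; rewrite setTI preimage_itvoy; apply: sub_sigma_algebra.
have nbhs_open (A : set M) : (forall x, A x -> nbhs x A) -> open A by rewrite openE.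
apply: nbhs_open => x /= ax; apply: contrapT => nx.
have [U [nU cU]] := nbhs_sequence x.
have /choice[u Hu] : forall n, exists y, U n y /\
    (\int[mu]_(z in B) ((q y z)%:E * (h z)%:E) <= a%:E)%E.
  move=> n; apply: contrapT => /forallNP H; apply: nx.
  apply: filterS (nU n) => y Uy; rewrite /= ltNge; apply/negP => ya.
  by apply: (H y); split.
have cux : u n @[n --> \oo] --> x.
  move=> V /cU[N HN]; exists N => // n /= Nn; apply: (HN n Nn).
  by case: (Hu n).
have cu z : ((q (u n) z)%:E * (h z)%:E)%E @[n --> \oo] --> ((q x z)%:E * (h z)%:E)%E.
  apply: cvgeZr => //; apply: cvg_EFin; first exact: nearW.
  have H := @cvg_comp _ _ _ u (q ^~ z) _ _ _ cux (@cq z x).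
  exact: H.
have : (\int[mu]_(z in B) ((q x z)%:E * (h z)%:E) <= a%:E)%E.
  have -> : (\int[mu]_(z in B) ((q x z)%:E * (h z)%:E) =
      \int[mu]_(z in B) limn_einf (fun n => (q (u n) z)%:E * (h z)%:E))%E.
    by apply: eq_integral => z _; rewrite (cvg_limn_einf_sup (cu z)).
  apply: le_trans (fatou _ _ _ _) _ => //.
  - by move=> n; apply: measurable_funTS; apply: emeasurable_funM; exact/measurable_EFinP.
  - by move=> n z _; rewrite mule_ge0 ?lee_fin.
  rewrite limn_einf_lim; apply: lime_le; first exact: is_cvg_einfs.
  apply: nearW => n; apply: le_trans (Hu n).2.
  by apply: ereal_inf_lbound; exists n => /=.
by rewrite leNgt ax.
Qed.

Import HBNNSimple.

Lemma measurable_lsc_integral (h : Borel M -> \bar R) :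
  measurable_fun setT h -> (forall y, 0 <= h y)%E ->
  measurable_fun setT
    ((fun x => \int[mu]_(y in B) ((q x y)%:E * h y))%E : Borel M -> \bar R).
Proof.
move=> mh h0; pose g := nnsfun_approx measurableT mh.
apply: (@emeasurable_fun_cvg _ (Borel M) R setT
  (fun n (x : Borel M) => \int[mu]_(y in B) ((q x y)%:E * (g n y)%:E))%E
  (fun x : Borel M => \int[mu]_(y in B) ((q x y)%:E * h y))%E).
  by move=> n; exact: measurable_lsc_integral_fin.
move=> x _.
have -> : (\int[mu]_(y in B) ((q x y)%:E * h y) =
    \int[mu]_(y in B) limn (fun n => (q x y)%:E * (g n y)%:E))%E.
  apply: eq_integral => y _; apply/esym/cvg_lim => //; apply: cvgeZl => //.
  exact: cvg_nnsfun_approx.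
apply: cvg_monotone_convergence => //.
- by move=> n; apply: measurable_funTS; apply: emeasurable_funM; exact/measurable_EFinP.
- by move=> n z _; rewrite mule_ge0 ?lee_fin.
- move=> y _ i j ij; rewrite lee_wpmul2l ?lee_fin//; exact/lefP/nd_nnsfun_approx.
Qed.

End Kernel.
End LowerSemicontinuous.

(** * Cylinders *)

Section CylinderSets.
Variables (R : realType) (M : ptopologicalType).
Notation X := (compactified M).
Notation Omega := (path_space R M).
Notation Paths := (g_sigma_algebraType (@coord_events R M)).
Implicit Types (l : seq (R * set M)) (a b s t : R) (B : set M).

(** The times increase strictly and start after a. *)
Fixpoint admissible a l : Prop :=
  if l is (s, B) :: l' then
    [/\ a < s, measurable (B : set (Borel M)) & admissible s l'] else True.

Fixpoint cylinder l : set Omega :=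
  if l is (s, B) :: l' then visits s B `&` cylinder l' else setT.

Definition delay b l := [seq (b + sB.1, sB.2) | sB <- l].

Definition cylinders : set (set Omega) :=
  [set C | exists2 l, admissible 0 l & C = cylinder l].

Lemma admissible_cat a l1 l2 :
  admissible a (l1 ++ l2) <-> admissible a l1 /\ admissible (last a (unzip1 l1)) l2.
Proof.
elim: l1 a => [|[s B] l1 IH] a /=; first by split=> // -[].
split=> [[as_ mB /IH[? ?]]|[[as_ mB H1] H2]]; first by split.
by split=> //; apply/IH.
Qed.

Lemma admissible_delay a b l : admissible a l -> admissible (b + a) (delay b l).
Proof.
elim: l a => [//|[s B] l IH] a /= [as_ mB al].
by split; rewrite ?ltrD2l//; exact: IH.
Qed.

Lemma cylinder_cat l1 l2 : cylinder (l1 ++ l2) = cylinder l1 `&` cylinder l2.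
Proof. by elim: l1 => [|[s B] l1 IH] /=; rewrite ?setTI// IH setIA. Qed.

Lemma measurable_cylinder a l : 0 <= a -> admissible a l ->
  measurable (cylinder l : set Paths).
Proof.
elim: l a => [|[s B] l IH] a a0 /=; first by move=> _; exact: measurableT.
move=> [as_ mB al]; have s0 := le_lt_trans a0 as_.
apply: measurableI; first exact: measurable_visits.
exact: IH (ltW s0) al.
Qed.

Lemma cylinder_delay a b l : 0 <= a -> admissible a l ->
  shift_path b @^-1` cylinder l = cylinder (delay b l).
Proof.
elim: l a => [|[s B] l IH] a a0 /=; first by rewrite preimage_setT.
move=> [as_ mB al]; have s0 := ltW (le_lt_trans a0 as_).
by rewrite preimage_setI visits_shift// (IH s).
Qed.

(** Adds the constraint X_t in B to a list ordered by time; when t is already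
    present the two sets are intersected, so the times remain strictly
    increasing. *)
Fixpoint insert t B l :=
  if l is (s, A) :: l' then
    if t < s then (t, B) :: l
    else if t == s then (s, A `&` B) :: l' else (s, A) :: insert t B l'
  else [:: (t, B)].

Lemma visitsI t A B : visits t (A `&` B) = visits t A `&` visits t B :> set Omega.
Proof. by rewrite /visits embed_imageI. Qed.

Lemma cylinder_insert t B l : cylinder (insert t B l) = visits t B `&` cylinder l.
Proof.
elim: l => [//|[s A] l IH] /=; case: ifP => // _; case: eqP => [->|_] /=.
  by rewrite visitsI [X in X `&` _]setIC setIA.
by rewrite IH setICA.
Qed.

Lemma admissible_insert a t B l : a < t -> measurable (B : set (Borel M)) ->
  admissible a l -> admissible a (insert t B l).
Proof.
elim: l a => [|[s A] l IH] a at_ mB /=; first by split.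
move=> [as_ mA al]; case: ifPn => [ts|]; first by split.
rewrite -leNgt le_eqVlt => /predU1P[st|st].
  by subst s; rewrite eqxx; split=> //; exact: (@measurableI _ (Borel M) _ _ mA mB).
by rewrite gt_eqF//; split => //; exact: IH.
Qed.

Lemma last_insert a t B l : a < t -> t <= last a (unzip1 l) ->
  last a (unzip1 (insert t B l)) = last a (unzip1 l).
Proof.
elim: l a => [|[s A] l IH] a at_ /=; first by rewrite leNgt at_.
by case: ltgtP => //= st tl; exact: IH.
Qed.

Lemma cylinderI : setI_closed cylinders.
Proof.
move=> _ _ [l1 al1 ->] [l2 al2 ->].
have : forall a, 0 <= a -> admissible a l1 ->
  exists2 l, admissible 0 l & cylinder l1 `&` cylinder l2 = cylinder l.
  elim: l1 {al1} => [|[s A] l1 IH] a a0 /=; first by exists l2; rewrite ?setTI.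
  move=> [as_ mA al1]; have s0 := le_lt_trans a0 as_.
  have [l al El] := IH s (ltW s0) al1; exists (insert s A l).
    exact: admissible_insert.
  by rewrite cylinder_insert -setIA El.
by move=> /(_ 0 (lexx 0) al1).
Qed.

Lemma cylindersT : cylinders setT. Proof. by exists [::]. Qed.

Lemma measurable_pathsE : @measurable _ Paths = <<s cylinders >>.
Proof.
apply/seteqP; split; apply: smallest_sub.
- exact: smallest_sigma_algebra.
- move=> _ [t [B [t0 mB ->]]]; apply: sub_sigma_algebra.
  by exists [:: (t, B)]; rewrite /= ?setIT.
- exact: sigma_algebra_measurable.
- by move=> _ [l al ->]; exact: measurable_cylinder al.
Qed.

(** The stopped path sees the times beyond b as b; they are merged there, and the
    conjunction with X_b in M makes b the last time of the resulting cylinder,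
    which is where a further list of delayed times can be appended. *)
Lemma cylinder_stop a b l : 0 <= a -> 0 < b -> admissible a l ->
  exists l', [/\ admissible 0 l', last 0 (unzip1 l') = b &
    stop_path b @^-1` cylinder l `&` visits b setT = cylinder l'].
Proof.
move=> + b0; elim: l a => [|[s A] l IH] a a0 /=.
  move=> _; exists [:: (b, setT)]; split => /=; rewrite ?preimage_setT ?setTI ?setIT//.
move=> [as_ mA al]; have s0 := le_lt_trans a0 as_.
have [l' [al' ll' El']] := IH s (ltW s0) al.
have m0 : 0 < Num.min s b by rewrite lt_min s0.
exists (insert (Num.min s b) A l'); split.
- exact: admissible_insert.
- by rewrite last_insert// ll' ge_min lexx orbT.
- by rewrite cylinder_insert -El' preimage_setI visits_stop ?ltW// setIA.
Qed.

End CylinderSets.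

(** * The exponential on extended reals *)

Section ExtendedExponential.
Variable R : realType.
Local Open Scope ereal_scope.

Lemma measurable_expeR : measurable_fun [set: \bar R] expeR.
Proof.
apply: (measurability _ (ErealGenOInfty.measurableE R)).
move=> _ [_ [a ->] <-]; rewrite setTI preimage_itvoy.
have [a0|a0] := leP 0%R a; last first.
  rewrite (_ : [set _ | _] = setT); first exact: measurableT.
  apply/seteqP; split=> // x _ /=; apply: lt_le_trans (expeR_ge0 x).
  by rewrite lte_fin.
have [y ya] := @expeR_total R a%:E a0.
rewrite (_ : [set _ | _] = setT `&` [set x | y < x]).
  exact: (emeasurable_fun_o_infty measurableT (@measurable_id _ _ setT)).
by rewrite setTI; apply/seteqP; split=> x /=; rewrite -ya lte_expeR.
Qed.

(** From e^x (1 - x) <= 1 one gets e^x <= 1 + x e^x <= 1 + x e^e. *)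
Lemma expeR_le_step (x y : \bar R) (e : R) : 0 <= x -> x <= e%:E ->
  expeR (x + y) <= expeR y + (expR e)%:E * (x * expeR y).
Proof.
case: x => // x; rewrite !lee_fin => x0 xe.
rewrite expeRD /= muleA -{2}[expeR y]mul1e -ge0_muleDl ?lee_fin ?mulr_ge0 ?expR_ge0//.
apply: lee_wpmul2r; first exact: expeR_ge0.
rewrite -EFinM -EFinD lee_fin.
have H : (expR x * (1 - x) <= 1)%R.
  by rewrite -[leRHS](expRxMexpNx_1 x) ler_pM2l ?expR_gt0// expR_ge1Dx.
have : (expR x * x <= expR e * x)%R by rewrite ler_wpM2r// ler_expR.
move: H; rewrite mulrBr mulr1; lra.
Qed.

(** The limit on the right is nonnegative, hence equal to expeR y for some y, and
    this y is an upper bound of the sequence u. *)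
Lemma expeR_lim (u : nat -> \bar R) (x : \bar R) : nondecreasing_seq u ->
  (forall n, 0 <= u n) -> u n @[n --> \oo] --> x ->
  expeR x <= limn (fun n => expeR (u n)).
Proof.
move=> ndu u0 ux.
have nde : nondecreasing_seq (fun n => expeR (u n)).
  by move=> i j ij; rewrite lee_expeR; exact: ndu.
have cve := ereal_nondecreasing_is_cvgn nde.
have [y ye] : exists y, expeR y = limn (fun n => expeR (u n)).
  by apply: expeR_total; apply: lime_ge => //; apply: nearW => n; exact: expeR_ge0.
rewrite -ye lee_expeR -(cvg_lim _ ux)//; apply: lime_le.
  by apply/cvg_ex; exists x.
apply: nearW => n; rewrite -lee_expeR ye; apply: lime_ge => //.
by exists n => // m /= nm; rewrite lee_expeR; exact: ndu.
Qed.

End ExtendedExponential.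

(** * Finite-dimensional distributions *)

Section MarkovProcess.
Variables (R : realType) (M : ptopologicalType).
Variables (mu : {measure set (Borel M) -> \bar R}) (p : R -> M -> M -> R).
Variable P : M -> probability (Borel (path_space R M)) R.
Notation X := (compactified M).
Notation emb := (@embed M).
Notation Omega := (path_space R M).
Notation Paths := (g_sigma_algebraType (@coord_events R M)).
Implicit Types (l : seq (R * set M)) (a b s t : R) (B : set M).
Local Open Scope ereal_scope.

Hypothesis hM : hausdorff_space M.
Hypothesis exM : forall U : set M, open U -> exhaustible U.
Hypothesis scM : @second_countable M.
Hypothesis p0 : forall t x y, (0 < t)%R -> (0 <= p t x y)%R.
Hypothesis cpx : forall t y, (0 < t)%R -> continuous (fun x => p t x y).
Hypothesis cpy : forall t x, (0 < t)%R -> continuous (p t x).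
Hypothesis hP : forall x0 : M, wiener_measure mu p x0 (P x0).

Section TransitionChain.
Implicit Types g h : Borel M -> \bar R.

(** For l = (t_1,B_1),...,(t_n,B_n) this is E[g(X_{t_n}); X_{t_i} in B_i for all i]
    for the process at x at time t, as an iterated integral of the kernel p. *)
Fixpoint chain t (x : M) l g : \bar R :=
  if l is (s, B) :: l' then
    \int[mu]_(y in B) ((p (s - t)%R x y)%:E * chain s y l' g) else g x.

Lemma measurable_p t x : (0 < t)%R -> measurable_fun setT (p t x : Borel M -> R).
Proof. by move=> t0; apply: measurable_continuous; exact: cpy. Qed.

Lemma chain_ge0 t x l g : admissible t l -> (forall y, 0 <= g y) -> 0 <= chain t x l g.
Proof.
elim: l t x => [|[s B] l IH] t x /=; first by move=> _; apply.
move=> [ts _ al] g0.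
apply: integral_ge0 => y _; rewrite mule_ge0 ?IH// lee_fin p0// subr_gt0//.
Qed.

Lemma measurable_chain t l g : admissible t l ->
  measurable_fun setT g -> (forall y, 0 <= g y) ->
  measurable_fun setT (fun x : Borel M => chain t x l g).
Proof.
elim: l t => [//|[s B] l IH] t /= [ts mB al] mg g0.
have st0 : (0 < s - t)%R by rewrite subr_gt0.
apply: (@measurable_lsc_integral R M scM mu (p (s - t)%R) B _ _ _ mB (fun y => chain s y l g)).
- by move=> x y; exact: p0.
- by move=> y; exact: cpx.
- by move=> x; exact: measurable_p.
- exact: IH.
- by move=> y; exact: chain_ge0.
Qed.

Lemma chain_cat t x l1 l2 g :
  chain t x (l1 ++ l2) g = chain t x l1 (fun y => chain (last t (unzip1 l1)) y l2 g).
Proof.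
elim: l1 t x => [//|[s B] l1 IH] t x /=.
by apply: eq_integral => y _; rewrite IH.
Qed.

Lemma chain_delay b t x l g : chain (b + t)%R x (delay b l) g = chain t x l g.
Proof.
elim: l t x => [//|[s B] l IH] t x /=.
by apply: eq_integral => y _; rewrite IH opprD addrACA subrr add0r.
Qed.

Let measurable_step s t x l g : (t < s)%R -> admissible s l ->
  measurable_fun setT g -> (forall y, 0 <= g y) ->
  measurable_fun setT (fun y : Borel M => (p (s - t)%R x y)%:E * chain s y l g).
Proof.
move=> ts al mg g0; apply: emeasurable_funM; last exact: measurable_chain.
by apply/measurable_EFinP; apply: measurable_p; rewrite subr_gt0.
Qed.

Lemma chain_linear (a : R) t x l g h : admissible t l -> (0 <= a)%R ->
  measurable_fun setT g -> measurable_fun setT h ->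
  (forall y, 0 <= g y) -> (forall y, 0 <= h y) ->
  chain t x l (fun y => a%:E * g y + h y) = a%:E * chain t x l g + chain t x l h.
Proof.
move=> + a0 mg mh g0 h0; elim: l t x => [//|[s B] l IH] t x /= [ts mB al].
have q0 y : (0 <= p (s - t) x y)%R by rewrite p0// subr_gt0.
rewrite -ge0_integralZl_EFin//; last 2 first.
- by move=> y _; rewrite mule_ge0 ?lee_fin// chain_ge0.
- by apply: measurable_funTS; exact: measurable_step.
rewrite -ge0_integralD//.
- apply: eq_integral => y _; rewrite IH// ge0_muleDr//; first by rewrite muleCA.
    by rewrite mule_ge0 ?lee_fin// chain_ge0.
  exact: chain_ge0.
- by move=> y _; rewrite !mule_ge0 ?lee_fin// chain_ge0.
- by apply: measurable_funTS; apply: measurable_funeM; exact: measurable_step.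
- by move=> y _; rewrite !mule_ge0 ?lee_fin// chain_ge0.
- by apply: measurable_funTS; exact: measurable_step.
Qed.

Lemma chain_le t x l g h : admissible t l ->
  measurable_fun setT g -> measurable_fun setT h ->
  (forall y, 0 <= g y) -> (forall y, g y <= h y) ->
  chain t x l g <= chain t x l h.
Proof.
move=> + mg mh g0 gh; elim: l t x => [|[s B] l IH] t x /=; first by move=> _; exact: gh.
move=> [ts mB al].
have q0 y : (0 <= p (s - t) x y)%R by rewrite p0// subr_gt0.
have h0 y : 0 <= h y by exact: le_trans (gh y).
apply: ge0_le_integral => //.
- by move=> y _; rewrite mule_ge0 ?lee_fin// chain_ge0.
- by apply: measurable_funTS; exact: measurable_step.
- by apply: measurable_funTS; exact: measurable_step.
- by move=> y _; rewrite lee_wpmul2l ?lee_fin// IH.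
Qed.

Lemma chain_lim t x l (g_ : nat -> Borel M -> \bar R) : admissible t l ->
  (forall n, measurable_fun setT (g_ n)) -> (forall n y, 0 <= g_ n y) ->
  (forall y, nondecreasing_seq (g_ ^~ y)) ->
  chain t x l (fun y => limn (g_ ^~ y)) = limn (fun n => chain t x l (g_ n)).
Proof.
move=> + mg g0 nd; elim: l t x => [//|[s B] l IH] t x /= [ts mB al].
have q0 y : (0 <= p (s - t) x y)%R by rewrite p0// subr_gt0.
have ndc y : nondecreasing_seq (fun n => chain s y l (g_ n)).
  by move=> i j ij; apply: chain_le => // z; exact: nd.
rewrite -monotone_convergence//.
- apply: eq_integral => y _; rewrite IH// limeMl//.
  exact: ereal_nondecreasing_is_cvgn.
- by move=> n; apply: measurable_funTS; exact: measurable_step.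
- by move=> n y _; rewrite mule_ge0 ?lee_fin// chain_ge0.
- by move=> y _ i j ij; rewrite lee_wpmul2l ?lee_fin// ndc.
Qed.

End TransitionChain.

Definition embed_list l : seq (R * set (Borel X)) := [seq (sB.1, emb @` sB.2) | sB <- l].

(** For sets inside M the extended measure and kernel reduce to mu and p, and the
    accumulated product a comes out of the integrals. *)
Lemma fdd_chain a t x l : (0 <= a)%R -> admissible t l ->
  fdd mu p a t (emb x) (embed_list l) = a%:E * chain t x l (cst 1).
Proof.
elim: l a t x => [|[s B] l IH] a t x a0 /=; first by rewrite mule1.
move=> [ts mB al].
have q0 y : (0 <= p (s - t) x y)%R by rewrite p0// subr_gt0.
have mc : measurable_fun setT (fun y : Borel M => (p (s - t)%R x y)%:E * chain s y l (cst 1)).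
  apply: emeasurable_funM; last by apply: measurable_chain.
  by apply/measurable_EFinP; apply: measurable_p => //; rewrite subr_gt0.
have c0 y : 0 <= (p (s - t)%R x y)%:E * chain s y l (cst 1).
  by rewrite mule_ge0 ?lee_fin//; exact: chain_ge0.
pose h : X -> \bar R := extend 0 (fun z => a%:E * ((p (s - t)%R x z)%:E * chain s z l (cst 1))).
transitivity (\int[ext_measure mu]_(y in emb @` B) h y).
  apply: eq_integral => y /set_mem[z Bz <-].
  rewrite IH//; last by rewrite /ext_kernel !inside_embed mulr_ge0.
  by rewrite /h extend_embed /ext_kernel !inside_embed EFinM muleA.
rewrite integral_ext_measure//.
- under eq_integral do rewrite /h extend_embed.
  by rewrite ge0_integralZl_EFin//; exact: measurable_funTS.
- by move=> y; rewrite /h /extend; case: inside => // z; rewrite mule_ge0.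
- rewrite (_ : h \o emb = fun z => a%:E * ((p (s - t)%R x z)%:E * chain s z l (cst 1))).
    exact: measurable_funeM.
  by apply/funext => z; rewrite /h /= extend_embed.
Qed.

Lemma law_cylinder x l : admissible 0 l -> P x (cylinder l) = chain 0 x l (cst 1).
Proof.
have sorted_times t : admissible t l -> path <%R t [seq tA.1 | tA <- embed_list l].
  by elim: l t => [//|[s B] l IH] t /= [-> _ /IH].
have measurable_sets t : admissible t l ->
    forall tA, tA \in embed_list l -> measurable tA.2.
  elim: l t {sorted_times} => [//|[s B] l IH] t /= [_ mB al] tA.
  rewrite inE => /predU1P[->|]; last exact: IH al _.
  exact: measurable_embed_image.
move=> al; rewrite -[RHS]mul1e -fdd_chain// -hP; last 2 first.
- exact: sorted_times.
- exact: measurable_sets al.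
congr (P x _); elim: l {al sorted_times measurable_sets} => [|[s B] l IH] /=.
  by rewrite big_nil.
by rewrite big_cons -IH.
Qed.

(** The position in M at time b, with a default value at infinity; it is only
    integrated over events on which X_b is in M. *)
Definition place b : Omega -> M := fun g : Omega => extend point id (coord_process b g).

Lemma measurable_place_borel b : measurable_fun setT (place b : Borel Omega -> Borel M).
Proof.
apply: (@measurableT_comp _ _ _ (Borel Omega) (Borel X) (Borel M)
  (extend point id) _ (coord_process b)).
  exact: (@measurable_extend M _ (Borel M) point id).
exact: measurable_coord.
Qed.

Lemma visits_place b A g : visits b setT g -> visits b A g <-> A (place b g).
Proof.
move=> [z _ zb]; rewrite /place -zb extend_embed.
split=> [[z' Az' zb']|Az]; last by exists z.
by have /embed_inj <- : emb z' = emb z by rewrite zb' zb.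
Qed.

Lemma visits_setT b B (g : Omega) : visits b B g -> visits b setT g.
Proof. by move=> [z _ zb]; exists z. Qed.

Lemma measurable_place b : (0 < b)%R -> measurable_fun setT (place b : Paths -> Borel M).
Proof.
move=> b0 _ A mA; rewrite setTI.
rewrite (_ : _ @^-1` _ = visits b A `|` (~` visits b setT `&` [set _ | A point])).
  apply: measurableU; first exact: measurable_visits.
  apply: measurableI; first by apply: measurableC; exact: measurable_visits.
  have [Aa|nA] := pselect (A point).
    by rewrite (_ : [set _ | A point] = setT) //; apply/seteqP; split.
  by rewrite (_ : [set _ | A point] = set0) //; apply/seteqP; split.
apply/seteqP; split=> g.
  move=> /= Ag; have [Tg|nT] := pselect (visits b setT g).
    by left; apply/visits_place.
  right; split=> //; move: Ag; rewrite /place /extend; case E : inside => [z|//].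
  by exfalso; apply: nT; exists z => //; rewrite (inside_Some E).
case=> [Ag|[nT Ap]]; first by apply/visits_place => //; exact: visits_setT Ag.
rewrite /= /place /extend; case E : inside => [z|//].
by exfalso; apply: nT; exists z => //; rewrite (inside_Some E).
Qed.

(** For g the indicator of A, this is the probability of the cylinder with B
    replaced by its intersection with A in the last constraint.  Both sides are
    linear and monotone continuous in g. *)
Lemma integral_cylinder x l b B (g : Borel M -> \bar R) : admissible 0 (rcons l (b, B)) ->
  measurable_fun setT g -> (forall y, 0 <= g y) ->
  \int[P x]_(w in cylinder (rcons l (b, B))) g (place b w) = chain 0 x (rcons l (b, B)) g.
Proof.
move=> al mg g0; set C := cylinder _.
have mC : measurable (C : set (Borel Omega)).
  have mC : measurable (C : set Paths) by exact: measurable_cylinder al.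
  by have := @measurable_coarsen R M measurableT _ mC; rewrite setTI.
have [al1 /= [lb mB _]] : admissible 0 l /\ admissible (last 0%R (unzip1 l)) [:: (b, B)].
  by apply/admissible_cat; rewrite cats1.
have CT w : C w -> visits b setT w.
  by rewrite /C -cats1 cylinder_cat => -[_ /= [/visits_setT]].
have mpl := measurable_place_borel b.
apply/esym.
rewrite (@ge0_functional_integral _ (Borel M) R
  (pushforward (mrestr (P x) mC) (place b : Borel Omega -> Borel M))
  (fun g => chain 0 x (rcons l (b, B)) g)) => //.
- rewrite ge0_integral_pushforward// integral_mrestr//.
    exact: measurableT_comp.
  by move=> w; exact: g0.
- move=> A mA; have mBA : measurable (B `&` A : set (Borel M)) by exact: measurableI.
  have albA : admissible 0 (rcons l (b, B `&` A)).
    by rewrite -cats1; apply/admissible_cat; split.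
  transitivity (chain 0 x (rcons l (b, B `&` A)) (cst 1)).
    rewrite -!cats1 !chain_cat; congr (chain 0 x l _); apply/funext => y /=.
    rewrite integral_mkcondr; apply: eq_integral => z _.
    by rewrite patchE indicE; case: ifP => _; rewrite ?mule1 ?mule0.
  rewrite -law_cylinder// /pushforward /mrestr /=; congr (P x _).
  rewrite /C -!cats1 !cylinder_cat /= !setIT visitsI.
  apply/seteqP; split=> w.
    by move=> [lw [Bw Aw]]; split=> //; apply/visits_place => //; exact: visits_setT Bw.
  move=> [Aw [lw Bw]]; split=> //; split=> //.
  by apply/visits_place => //; exact: visits_setT Bw.
- by move=> a u v a0 mu_ mv u0 v0; exact: chain_linear.
- by move=> u mu_ u0 nd; exact: chain_lim.
Qed.

(** * The Markov property at a fixed time *)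

(** The Wiener measure restricted to the sigma-algebra of [coord_events], as a
    point of the measurable space of measures; its measurable dependence on x is
    a statement about a map into that space. *)
Definition law (x : Borel M) : giry Paths R := giry_map (@measurable_coarsen R M) (P x).

Lemma lawE x E : law x E = P x E. Proof. by []. Qed.

Lemma law_setT x : law x setT = 1. Proof. by rewrite lawE probability_setT. Qed.

Lemma integral_law x (f : Paths -> \bar R) : measurable_fun setT f -> (forall w, 0 <= f w) ->
  \int[law x]_w f w = \int[P x]_w f w.
Proof. by move=> mf f0; exact: (giry_int_map (@measurable_coarsen R M) (P x) mf f0). Qed.

(** The events whose probability is a measurable function of x form a Dynkin
    system containing the cylinders, which are stable under intersection. *)
Lemma measurable_law : measurable_fun setT law.
Proof.
apply: measurable_giry_codensity => // E mE.
move: E mE; rewrite measurable_pathsE; apply: dynkin_induction.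
- by rewrite measurable_pathsE.
- exact: cylinderI.
- by apply: (eq_measurable_fun (cst 1)) => // x _; rewrite law_setT.
- move=> _ [l al ->].
  apply: (eq_measurable_fun (fun x : Borel M => chain 0 x l (cst 1))).
    by move=> x _; rewrite lawE law_cylinder.
  by apply: measurable_chain.
- move=> S mS IH; apply: (eq_measurable_fun (fun x => 1 - law x S)).
    move=> x _; rewrite -(law_setT x) -(setUv S) measureU ?setICr//.
      by rewrite addeAC subee ?add0e//; exact: fin_num_measure.
    exact: measurableC.
  exact: emeasurable_funB.
- move=> F mF tF Fn; apply: (eq_measurable_fun (fun x => \sum_(0 <= k <oo) law x (F k))).
    by move=> x _; rewrite measure_semi_bigcup//; exact: bigcup_measurable.
  exact: ge0_emeasurable_sum.
Qed.

(** The law of a fresh path started at X_b.  No law starts at infinity: the zero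
    measure there encodes the restriction to the event X_b in M. *)
Definition restart (b : R) (w : Paths) : giry Paths R :=
  if `[< visits b setT w >] then law (place b w) else @mzero _ Paths R.

Lemma measurable_restart b : (0 < b)%R -> measurable_fun setT (restart b).
Proof.
move=> b0; apply: measurable_giry_codensity => // E mE.
apply: (eq_measurable_fun
    (fun w : Paths => (\1_(visits b setT) w)%:E * law (place b w) E)).
  move=> w _; rewrite /restart indicE; case: asboolP => wT.
    by rewrite mem_set// mul1e.
  by rewrite memNset// mul0e.
have mV : measurable (visits b setT : set Paths) by exact: measurable_visits.
apply: emeasurable_funM; first by apply/measurable_EFinP; exact: measurable_indic.
apply: (@measurableT_comp _ _ _ _ _ _ (fun y => law y E)).
  exact: (measurableT_comp (measurable_giry_ev mE) measurable_law).
exact: measurable_place.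
Qed.

Section AtTime.
Variables (b : R) (b0 : (0 < b)%R).

Let A : set Paths := visits b setT.
Let mA : measurable A. Proof. exact: measurable_visits. Qed.
Let phi (w : Paths) : Paths * Paths := (stop_path b w, shift_path b w).
Let mphi : measurable_fun setT phi.
Proof.
apply: measurable_fun_pair; first exact: measurable_stop.
by apply: measurable_shift; exact: ltW.
Qed.
Let kappa (w : Paths) : giry (Paths * Paths)%type R :=
  giry_prod (giry_ret (stop_path b w : Paths), restart b w).
Let mkappa : measurable_fun setT kappa.
Proof.
apply: (measurableT_comp measurable_giry_prod); apply: measurable_fun_pair.
  apply: (measurableT_comp measurable_giry_ret); exact: measurable_stop.
exact: measurable_restart.
Qed.

(** On the event X_b in M, [cut_law] is the joint distribution of the stopped and
    the shifted path, and [glued_law] that of the stopped path and an independent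
    restart from X_b.  The Markov property is the equality of the two measures. *)
Let cut_law x : {measure set (Paths * Paths) -> \bar R} :=
  measure_function_pushforward__canonical__measure_function_Measure
    (mrestr (law x) mA) mphi.
Let glued_law x := giry_bind (law x) mkappa.

(** Both sides equal the iterated integral over the cylinder obtained from l1 by
    stopping at b, of the probability of cylinder l2 under the law started at its
    last point, X_b. *)
Let cut_glued_cylinder x l1 l2 : admissible 0 l1 -> admissible 0 l2 ->
  cut_law x (cylinder l1 `*` cylinder l2) = glued_law x (cylinder l1 `*` cylinder l2).
Proof.
move=> al1 al2.
have mK1 : measurable (cylinder l1 : set Paths) by exact: measurable_cylinder al1.
have mK2 : measurable (cylinder l2 : set Paths) by exact: measurable_cylinder al2.
have [l [al ll El]] := cylinder_stop (lexx 0%R) b0 al1.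
have mC : measurable (cylinder l : set Paths) by exact: measurable_cylinder al.
have mCB : measurable (cylinder l : set (Borel Omega)).
  by have := @measurable_coarsen R M measurableT _ mC; rewrite setTI.
have mlaw : measurable_fun setT (fun y => law y (cylinder l2)).
  exact: (measurableT_comp (measurable_giry_ev mK2) measurable_law).
transitivity (chain 0 x l (fun y => law y (cylinder l2))).
  have albl : admissible 0 (l ++ delay b l2).
    by apply/admissible_cat; rewrite ll -{1}[b]addr0; split=> //; exact: admissible_delay.
  transitivity (P x (cylinder (l ++ delay b l2))).
    rewrite /cut_law /pushforward /mrestr /= lawE; congr (P x _).
    rewrite cylinder_cat -(cylinder_delay b (lexx 0%R) al2) -El.
    apply/seteqP; split=> w; first by move=> [[]].
    by move=> [[]].
  rewrite law_cylinder// chain_cat ll; congr (chain 0 x l _).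
  apply/funext => y; rewrite -{1}[b]addr0 chain_delay lawE.
  by rewrite law_cylinder.
have [l' [B lE]] : exists l' B, l = rcons l' (b, B).
  case/lastP: l ll {al El mC mCB} => [|l' [s B]]; first by move=> /eqP; rewrite /= lt_eqF.
  by rewrite /unzip1 map_rcons last_rcons /= => ->; exists l', B.
transitivity (\int[law x]_(w in cylinder l) law (place b w) (cylinder l2)).
  rewrite lE -integral_cylinder//; last by rewrite -lE.
  rewrite -lE [LHS]integral_mkcond [RHS]integral_mkcond -integral_law//.
  - by apply/(measurable_restrictT _ _).1 => //; apply: measurable_funTS;
      apply: (measurableT_comp mlaw); exact: measurable_place.
  - by move=> w; rewrite patchE; case: ifP.
have -> : glued_law x (cylinder l1 `*` cylinder l2) =
    \int[law x]_w kappa w (cylinder l1 `*` cylinder l2).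
  apply: (giry_int_map mkappa (law x) (measurable_giry_ev (measurableX mK1 mK2))).
  by move=> m; exact: measure_ge0.
rewrite [LHS]integral_mkcond; apply: eq_integral => w _.
rewrite patchE /giry_ev /kappa /giry_prod [RHS]product_measure1E//.
rewrite /giry_ret /= diracE /restart; case: asboolP => wT; last first.
  by rewrite mule0 memNset// -El => -[].
case: ifPn => wl.
  by rewrite mem_set ?mul1e//; move/set_mem : wl; rewrite -El => -[].
by rewrite memNset ?mul0e// => sw; move/negP : wl; apply; apply/mem_set; rewrite -El.
Qed.

Let rects : set (set (Paths * Paths)) :=
  [set K `*` E | K in @cylinders R M & E in @cylinders R M].

Let measurable_rects : @measurable _ (Paths * Paths)%type = <<s rects >>.
Proof.
apply/seteqP; split; last first.
  apply: smallest_sub; first exact: sigma_algebra_measurable.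
  by move=> _ [_ [l1 al1 ->] [_ [l2 al2 ->] <-]]; apply: measurableX;
    [exact: measurable_cylinder al1|exact: measurable_cylinder al2].
pose T := g_sigma_algebraType rects.
have mfst : measurable_fun setT (fst : T -> Paths).
  apply: (measurability _ (measurable_pathsE R M)) => _ [K cK <-].
  rewrite setTI; apply: sub_sigma_algebra; exists K => //; exists setT.
    exact: cylindersT.
  by apply/seteqP; split=> -[u v] //= [].
have msnd : measurable_fun setT (snd : T -> Paths).
  apply: (measurability _ (measurable_pathsE R M)) => _ [E cE <-].
  rewrite setTI; apply: sub_sigma_algebra; exists setT; first exact: cylindersT.
  by exists E => //; apply/seteqP; split=> -[u v] //= [].
apply: smallest_sub; first exact: smallest_sigma_algebra.
move=> S [[K mK <-]|[E mE <-]]; [exact: mfst|exact: msnd].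
Qed.

Let cut_glued x S : measurable S -> cut_law x S = glued_law x S.
Proof.
apply: (measure_unique rects (fun=> setT)) => //.
- move=> _ _ [K1 cK1 [E1 cE1 <-]] [K2 cK2 [E2 cE2 <-]].
  exists (K1 `&` K2); first exact: cylinderI.
  by exists (E1 `&` E2); [exact: cylinderI|rewrite setXI].
- move=> _; exists setT; first exact: cylindersT.
  by exists setT; [exact: cylindersT|rewrite setXTT].
- by rewrite bigcup_const.
- by move=> _ [_ [l1 al1 ->] [_ [l2 al2 ->] <-]]; exact: cut_glued_cylinder.
- move=> _; have -> : cut_law x setT = law x (phi @^-1` setT `&` A) by [].
  rewrite preimage_setT setTI; apply: le_lt_trans (ltry 1).
  by rewrite -(law_setT x); apply: le_measure; rewrite ?inE.
Qed.

Lemma markov_property x (H G : Paths -> \bar R) :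
  measurable_fun setT H -> measurable_fun setT G ->
  (forall w, 0 <= H w) -> (forall w, 0 <= G w) ->
  \int[law x]_(w in visits b setT) (H (stop_path b w) * G (shift_path b w)) =
  \int[law x]_w (H (stop_path b w) * \int[restart b w]_v G v).
Proof.
move=> mH mG H0 G0.
pose f (z : Paths * Paths) := H z.1 * G z.2.
have mf : measurable_fun setT f by apply: emeasurable_funM; exact: measurableT_comp.
have f0 z : 0 <= f z by exact: mule_ge0.
transitivity (\int[cut_law x]_z f z).
  transitivity (\int[mrestr (law x) mA]_w f (phi w)).
    by rewrite integral_mrestr//; exact: measurableT_comp.
  apply/esym; apply: (ge0_integral_pushforward mphi (mrestr (law x) mA)) => //.
transitivity (\int[glued_law x]_z f z).
  by apply: eq_measure_integral => S mS _; exact: cut_glued.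
rewrite [LHS](giry_int_bind (law x) mkappa mf f0).
apply: eq_integral => w _.
rewrite /kappa giry_int_prod1// giry_int_ret//.
  by rewrite /f /= /giry_int ge0_integralZl.
exact: (measurable_fun_fubini_tonelli_F f).
Qed.

(** A uniform bound c on the expectations of G bounds the conditional expectation
    of G of the shifted path. *)
Lemma markov_le x (H G : Paths -> \bar R) (c : \bar R) : 0 <= c ->
  measurable_fun setT H -> measurable_fun setT G ->
  (forall w, 0 <= H w) -> (forall w, 0 <= G w) ->
  (forall y, \int[law y]_v G v <= c) ->
  \int[law x]_(w in visits b setT) (H (stop_path b w) * G (shift_path b w)) <=
  c * \int[law x]_(w in visits b setT) H (stop_path b w).
Proof.
move=> c0 mH mG H0 G0 Gc; rewrite markov_property//.
have mHs : measurable_fun setT (fun w : Paths => H (stop_path b w)).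
  by apply: (measurableT_comp mH); exact: measurable_stop.
rewrite -ge0_integralZl//; last exact: measurable_funTS.
rewrite [leRHS]integral_mkcond; apply: ge0_le_integral => //.
- by move=> w _; rewrite mule_ge0// integral_ge0.
- apply: emeasurable_funM => //.
  apply: (measurableT_comp (measurable_giry_int mG G0)).
  exact: measurable_restart.
- apply/(measurable_restrictT _ _).1 => //; apply: measurable_funTS.
  exact: measurable_funeM.
- move=> w _; rewrite patchE /restart; case: asboolP => wT.
    by rewrite mem_set// muleC lee_wpmul2r.
  by rewrite memNset// integral_measure_zero mule0.
Qed.

End AtTime.

Lemma integral_law1 x : \int[law x]_w 1 = 1.
Proof.
transitivity (1 * law x setT); first exact: (integral_cst (law x) measurableT 1).
by rewrite law_setT mul1e.
Qed.

(** * Khas'minskii's lemma *)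

Section ExponentialMoment.
Variable f : Borel M -> R.
Hypothesis mf : measurable_fun setT f.
Hypothesis f0 : forall x, (0 <= f x)%R.

Notation occ := (occupation f).

Let mocc a b : (0 <= a)%R -> measurable_fun setT (occ a b : Paths -> \bar R).
Proof. by move=> a0; exact: measurable_occupation. Qed.

Let mexp a b : (0 <= a)%R -> measurable_fun setT (fun w : Paths => expeR (occ a b w)).
Proof. by move=> a0; apply: (measurableT_comp (@measurable_expeR R)); exact: mocc. Qed.

(** Where X_r is in M, A(r,r+u) is at most A(0,u) of the shifted path and the
    Markov property applies.  Elsewhere the path is dead at r, so A(r,r+u) = 0,
    and 1 <= c suffices.  Dependence of the first factor on the path up to r is
    expressed by evaluating H at the stopped path. *)
Lemma exp_markov (r u : R) x (H : Paths -> \bar R) (c : R) : (0 < r)%R -> (1 <= c)%R ->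
  measurable_fun setT H -> (forall w, 0 <= H w) ->
  (forall y, \int[law y]_v expeR (occ 0 u v) <= c%:E) ->
  \int[law x]_w (H (stop_path r w) * expeR (occ r (r + u) w)) <=
  c%:E * \int[law x]_w H (stop_path r w).
Proof.
move=> r0 c1 mH H0 Hc; pose A : set Paths := visits r setT.
have mA : measurable A by exact: measurable_visits.
have mHs : measurable_fun setT (fun w : Paths => H (stop_path r w)).
  by apply: (measurableT_comp mH); exact: measurable_stop.
have mE : measurable_fun setT (fun w : Paths => expeR (occ r (r + u) w)).
  by apply: mexp; exact: ltW.
have split_int (h : Paths -> \bar R) : measurable_fun setT h -> (forall w, 0 <= h w) ->
    \int[law x]_w h w = \int[law x]_(w in A) h w + \int[law x]_(w in ~` A) h w.
  move=> mh h0; rewrite -ge0_integral_setU ?setUv//.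
  - exact: measurableC.
  - by apply/disj_setPCl.
rewrite split_int; last 2 first.
- exact: emeasurable_funM.
- by move=> w; rewrite mule_ge0// expeR_ge0.
rewrite (split_int _ mHs)// ge0_muleDr; [|exact: integral_ge0..].
have c0 : (0 <= c)%R by exact: le_trans c1.
have mG : measurable_fun setT (fun w : Paths => expeR (occ 0 u w)) by exact: mexp.
have G0 (w : Paths) : 0 <= expeR (occ 0 u w) by exact: expeR_ge0.
have K := @markov_le r r0 x H _ c%:E c0 mH mG H0 G0 Hc.
apply: leeD.
  apply: le_trans K; apply: ge0_le_integral => //.
  - by move=> w _; rewrite mule_ge0// expeR_ge0.
  - by apply: measurable_funTS; exact: emeasurable_funM.
  - apply: measurable_funTS; apply: emeasurable_funM => //.
    by apply: (measurableT_comp mG); apply: measurable_shift; exact: ltW.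
  - move=> w _; rewrite lee_wpmul2l// lee_expeR occupation_shift//; last exact: ltW.
    rewrite /alive; case: (_ < _); rewrite ?mul1e ?mul0e//.
    exact: occupation_ge0.
rewrite -ge0_integralZl//; [|exact: measurableC|exact: measurable_funTS].
apply: ge0_le_integral => //.
- exact: measurableC.
- by move=> w _; rewrite mule_ge0// expeR_ge0.
- by apply: measurable_funTS; exact: emeasurable_funM.
- by apply: measurable_funTS; exact: measurable_funeM.
move=> w nA; rewrite muleC lee_wpmul2r//.
rewrite occupation_shift//; last exact: ltW.
rewrite /alive; case: ltP => [/(alive_stays _ (ltW r0)) rz|_].
  by exfalso; apply: nA; apply: rz; rewrite lexx ltW.
by rewrite mul0e expeR0 lee_fin.
Qed.

Lemma occupation_mono a b c (w : Omega) : (0 <= a)%R -> (a <= b)%R -> (b <= c)%R ->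
  occ a b w <= occ a c w.
Proof.
by move=> a0 ab bc; rewrite (occupation_cat hM exM mf f0 w a0 ab bc) leeDl// occupation_ge0.
Qed.

(** One factor K for each block of length s, by the Markov property at the start of
    the last block. *)
Lemma exp_blocks (s K : R) n x : (0 < s)%R -> (1 <= K)%R ->
  (forall y, \int[law y]_v expeR (occ 0 s v) <= K%:E) ->
  \int[law x]_w expeR (occ 0 (n.+1%:R * s) w) <= (K ^+ n.+1)%:E.
Proof.
move=> s0 K1 HK; elim: n => [|n IH]; first by rewrite mul1r expr1.
pose r := (n.+1%:R * s)%R; have r0 : (0 < r)%R by rewrite mulr_gt0.
have -> : (n.+2%:R * s = r + s)%R by rewrite /r -[n.+2%:R]natr1; ring.
have E0 (w : Paths) : 0 <= expeR (occ 0 r w) by exact: expeR_ge0.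
have := @exp_markov r s x
  (fun w => expeR (occ 0 r w)) K r0 K1 (mexp r (lexx 0%R)) E0 HK.
have Es (w : Paths) : occ 0 r (stop_path r w) = occ 0 r w by exact: occupation_stop.
under eq_integral do rewrite Es.
under [X in _ <= _ * X]eq_integral do rewrite Es.
have E (w : Paths) : expeR (occ 0 (r + s) w) = expeR (occ 0 r w) * expeR (occ r (r + s) w).
  rewrite -expeRD; congr expeR; apply: (occupation_cat hM exM mf f0) => //.
    exact: ltW.
  by rewrite lerDl ltW.
under [X in _ -> X <= _]eq_integral do rewrite E.
move=> /le_trans; apply; rewrite exprS EFinM lee_wpmul2l// lee_fin.
exact: le_trans K1.
Qed.

Section Bounded.
Variable N : R.
Hypothesis fN : forall x, (f x <= N)%R.

Let N0 : (0 <= N)%R. Proof. exact: le_trans (f0 point) (fN point). Qed.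

Lemma occupation_le a b (w : Omega) : (0 <= a)%R -> (a <= b)%R ->
  occ a b w <= (N * (b - a))%:E.
Proof.
move=> a0 ab; rewrite /occupation.
apply: (@le_trans _ _ (\int[lebesgue_measure]_(r in `]a, b]) (cst N%:E) r)).
  apply: ge0_le_integral => //.
  - by move=> r _; rewrite lee_fin killed_ge0.
  - by apply/measurable_EFinP; exact: measurable_killed_section.
  - move=> r _; rewrite lee_fin /killed.
    rewrite -[leRHS]mulr1 ler_pM ?alive_ge0 ?extend_ge0//.
      by rewrite /extend; case: inside => // z.
    by rewrite /alive; case: (_ < _).
rewrite integral_cst//= lebesgue_measure_itv/= lte_fin.
case: ltP => [_|ba]; first by rewrite -EFinB -EFinM.
by rewrite mule0 lee_fin mulr_ge0// subr_ge0.
Qed.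

(** Induction on the number k of steps of length h counted backwards from s.  The
    new step [a,r] contributes an increment u = A(a,r) <= N h, for which
    e^{u+v} <= e^v + e^{Nh} u e^v with v = A(r,s); the last term is bounded by the
    Markov property at r and the bound V on E^y[e^{A(0,s-r)}]. *)
Lemma exp_occupation_le (s h V : R) (k : nat) x : (0 < h)%R -> (1 <= V)%R -> (k%:R * h <= s)%R ->
  (forall y, \int[law y]_v expeR (occ 0 s v) <= V%:E) ->
  \int[law x]_w expeR (occ (s - k%:R * h) s w) <=
    1 + (expR (N * h) * V)%:E * \int[law x]_w occ (s - k%:R * h) s w.
Proof.
move=> h0 V1 + HV; have V0 : (0 <= V)%R by exact: le_trans V1.
elim: k => [|k IH].
  move=> s0; rewrite mul0r subr0.
  have E0 (w : Paths) : occ s s w = 0 by rewrite /occupation set_itvoc0 integral_set0.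
  under eq_integral do rewrite E0 expeR0.
  under [X in _ <= _ + _ * X]eq_integral do rewrite E0.
  by rewrite integral0 mule0 adde0 integral_law1.
move=> ks; pose a := (s - k.+1%:R * h)%R; pose r := (s - k%:R * h)%R.
have ar : r = (a + h)%R by rewrite /a /r -natr1; ring.
have a0 : (0 <= a)%R by rewrite subr_ge0.
have r0 : (0 < r)%R by rewrite ar ltr_wpDl.
have rs : (r <= s)%R by rewrite gerBl mulr_ge0// ltW.
have le_ar : (a <= r)%R by rewrite ar lerDl ltW.
rewrite -/a; rewrite -/r in IH.
have {}IH : \int[law x]_w expeR (occ r s w) <= 1 + (expR (N * h) * V)%:E * \int[law x]_w occ r s w.
  by apply: IH; rewrite -subr_ge0 ltW.
have e0 : (0 <= expR (N * h))%R by exact: expR_ge0.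
have mar := mocc r a0. have mrs := mocc s (ltW r0). have ers := mexp s (ltW r0).
have occ0 c d (w : Paths) : 0 <= occ c d w by exact: occupation_ge0.
have mM : measurable_fun setT (fun w : Paths => occ a r w * expeR (occ r s w)).
  exact: emeasurable_funM.
have M0 (w : Paths) : 0 <= occ a r w * expeR (occ r s w).
  by rewrite mule_ge0// expeR_ge0.
have step1 : \int[law x]_w expeR (occ a s w) <=
   \int[law x]_w expeR (occ r s w) +
   (expR (N * h))%:E * \int[law x]_w (occ a r w * expeR (occ r s w)).
  rewrite -ge0_integralZl_EFin// -ge0_integralD//; last 3 first.
  - by move=> w _; exact: expeR_ge0.
  - by move=> w _; rewrite mule_ge0 ?lee_fin.
  - exact: measurable_funeM.
  apply: ge0_le_integral => //.
  - by move=> w _; exact: expeR_ge0.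
  - exact: mexp.
  - by apply: emeasurable_funD => //; exact: measurable_funeM.
  - move=> w _; rewrite (occupation_cat hM exM mf f0 w a0 le_ar rs).
    apply: expeR_le_step => //; apply: le_trans (occupation_le w a0 le_ar) _.
    by rewrite lee_fin ar addrAC subrr add0r.
have step2 : \int[law x]_w (occ a r w * expeR (occ r s w)) <= V%:E * \int[law x]_w occ a r w.
  have HVr y : \int[law y]_v expeR (occ 0 (s - r) v) <= V%:E.
    apply: le_trans (HV y); apply: ge0_le_integral => //.
    - by move=> w _; exact: expeR_ge0.
    - exact: mexp.
    - exact: mexp.
    - move=> w _; rewrite lee_expeR; apply: occupation_mono => //.
        by rewrite subr_ge0.
      by rewrite gerBl ltW.
  have K := @exp_markov r (s - r) x
    (occ a r) V r0 V1 mar (occ0 a r) HVr.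
  have Es (w : Paths) : occ a r (stop_path r w) = occ a r w by exact: occupation_stop.
  have rE : (r + (s - r))%R = s by rewrite addrC subrK.
  rewrite rE in K.
  under eq_integral do rewrite -Es.
  by under [X in _ <= _ * X]eq_integral do rewrite -Es.
have -> : \int[law x]_w occ a s w = \int[law x]_w occ a r w + \int[law x]_w occ r s w.
  rewrite -ge0_integralD//.
  by apply: eq_integral => w _; exact: (occupation_cat hM exM mf f0 w a0 le_ar rs).
apply: le_trans step1 _; rewrite addeC.
apply: (@le_trans _ _ ((expR (N * h))%:E * (V%:E * \int[law x]_w occ a r w) +
   (1 + (expR (N * h) * V)%:E * \int[law x]_w occ r s w))).
  by apply: leeD => //; apply: lee_wpmul2l => //; rewrite lee_fin.
have : 0 <= \int[law x]_w occ a r w by apply: integral_ge0 => w _.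
have : 0 <= \int[law x]_w occ r s w by apply: integral_ge0 => w _.
move: (\int[law x]_w occ a r w) (\int[law x]_w occ r s w) => i1 i2 i20 i10.
by rewrite muleA -EFinM addeCA ge0_muleDr.
Qed.

(** With V the supremum of the left-hand side, the n-step estimate reads
    V <= 1 + e^{Ns/n} V d.  Boundedness of f makes V finite, so letting n tend to
    infinity and solving for V gives 1/(1-d). *)
Lemma khasminskii_bounded (s d : R) x : (0 < s)%R -> (d < 1)%R ->
  (forall y, \int[law y]_v occ 0 s v <= d%:E) ->
  \int[law x]_w expeR (occ 0 s w) <= ((1 - d)^-1)%:E.
Proof.
move=> s0 d1 Hd; pose E y := \int[law y]_w expeR (occ 0 s w).
have Eub y : E y <= (expR (N * s))%:E.
  apply: (@le_trans _ _ (\int[law y]_w cst (expR (N * s))%:E w)).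
    apply: ge0_le_integral => //.
    - by move=> w _; exact: expeR_ge0.
    - exact: mexp.
    - move=> w _; rewrite -[leRHS]/(expeR (N * s)%:E) lee_expeR.
      by have := occupation_le w (lexx 0%R) (ltW s0); rewrite subr0.
  by rewrite integral_cst//= [X in _ * X](law_setT y) mule1.
have Elb y : 1 <= E y.
  rewrite -(integral_law1 y); apply: ge0_le_integral => //.
  - exact: mexp.
  - by move=> w _; rewrite -expeR0 lee_expeR occupation_ge0.
have d0 : (0 <= d)%R.
  rewrite -lee_fin; apply: le_trans (Hd x); apply: integral_ge0 => w _.
  exact: occupation_ge0.
pose S := ereal_sup (range E).
have ES y : E y <= S by apply: ereal_sup_ubound; exists y.
have S1 : 1 <= S by exact: le_trans (Elb x) (ES x).
have Sub : S <= (expR (N * s))%:E by apply: ge_ereal_sup => _ [y _ <-].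
have SV : S = (fine S)%:E.
  by rewrite fineK// ge0_fin_numE ?(le_trans _ S1)// (le_lt_trans Sub) ?ltry.
set V := fine S in SV.
have V1 : (1 <= V)%R by rewrite -lee_fin -SV.
have HV y : \int[law y]_v expeR (occ 0 s v) <= V%:E by rewrite -SV; exact: ES.
have Vn (n : nat) : (V <= 1 + expR (N * s / n.+1%:R) * (V * d))%R.
  rewrite -lee_fin -[leLHS]SV; apply: ge_ereal_sup => _ [y _ <-].
  have h0 : (0 < s / n.+1%:R)%R by rewrite divr_gt0.
  have ks : (n.+1%:R * (s / n.+1%:R) = s)%R by rewrite mulrC divfK.
  have := @exp_occupation_le s (s / n.+1%:R) V n.+1 y h0 V1.
  rewrite ks lexx subrr => /(_ isT HV) /le_trans; apply.
  have -> : (expR (N * s / n.+1%:R) * (V * d) = expR (N * (s / n.+1%:R)) * V * d)%R.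
    by rewrite !mulrA.
  rewrite EFinD [X in _ <= _ + X]EFinM leeD2l// lee_wpmul2l//.
  by rewrite lee_fin mulr_ge0 ?expR_ge0// (le_trans _ V1).
have VV : (V <= 1 + V * d)%R.
  have c : (fun n : nat => 1 + expR (N * s / n.+1%:R) * (V * d))%R @ \oo --> (1 + V * d)%R.
    have cz : (fun n : nat => N * s / n.+1%:R)%R @ \oo --> (N * s * 0)%R.
      by apply: cvgM; [exact: cvg_cst|exact: cvg_harmonic].
    have ce : (fun n : nat => expR (N * s / n.+1%:R)) @ \oo --> expR (N * s * 0).
      by apply: continuous_cvg => //; exact: continuous_expR.
    rewrite mulr0 expR0 in ce.
    have := cvgM ce (cvg_cst (V * d)%R); rewrite mul1r => cm.
    by apply: cvgD; [exact: cvg_cst|exact: cm].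
  rewrite -(cvg_lim (@Rhausdorff R) c); apply: limr_ge.
    by apply/cvg_ex; eexists; exact: c.
  exact: nearW.
apply: le_trans (HV x) _; rewrite lee_fin -[leRHS]mul1r ler_pdivlMr ?subr_gt0//.
by rewrite mulrBr mulr1 lerBlDr.
Qed.

(** With n the integer part of t/s, the n + 1 blocks of length s cover [0,t] and
    K^{n+1} <= K e^{(t/s) log K} as K >= 1. *)
Lemma khasminskii_growth (s d t : R) x : (0 < s)%R -> (d < 1)%R -> (0 <= t)%R ->
  (forall y, \int[law y]_v occ 0 s v <= d%:E) ->
  \int[law x]_w expeR (occ 0 t w) <=
    ((1 - d)^-1 * expR (t * (s^-1 * ln ((1 - d)^-1))))%:E.
Proof.
move=> s0 d1 t0 Hd; set K := ((1 - d)^-1)%R.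
have d0 : (0 <= d)%R.
  rewrite -lee_fin; apply: le_trans (Hd x); apply: integral_ge0 => w _.
  exact: occupation_ge0.
have K1 : (1 <= K)%R by rewrite /K invf_ge1 ?subr_gt0// gerBl.
have K0 : (0 < K)%R by exact: lt_le_trans K1.
have ts0 : (0 <= t / s)%R by rewrite divr_ge0// ltW.
pose n := Num.truncn (t / s).
have /andP[nts tsn] : (n%:R <= t / s < n.+1%:R)%R by exact: truncn_itv.
apply: (@le_trans _ _ (\int[law x]_w expeR (occ 0 (n.+1%:R * s) w))).
  apply: ge0_le_integral => //.
  - by move=> w _; exact: expeR_ge0.
  - exact: mexp.
  - exact: mexp.
  - move=> w _; rewrite lee_expeR; apply: occupation_mono => //.
    by rewrite -ler_pdivrMr// ltW.
apply: (le_trans (exp_blocks n x s0 K1 (fun y => khasminskii_bounded y s0 d1 Hd))).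
rewrite lee_fin exprS; apply: ler_wpM2l; first exact: ltW.
have -> : (K ^+ n = expR (n%:R * ln K))%R by rewrite expRM_natl lnK// posrE.
rewrite ler_expR mulrA ler_wpM2r//.
exact: ln_ge0.
Qed.

End Bounded.

End ExponentialMoment.

Section Truncation.
Variable f : Borel M -> R.
Hypothesis mf : measurable_fun setT f.
Hypothesis f0 : forall x, (0 <= f x)%R.

Let trunc (n : nat) (y : Borel M) : R := Num.min (f y) n%:R.

Let mtrunc n : measurable_fun setT (trunc n).
Proof. exact: measurable_minr. Qed.

Let trunc0 n y : (0 <= trunc n y)%R.
Proof. by rewrite le_min f0 ler0n. Qed.

Let nd_killed r (w : Omega) : nondecreasing_seq (fun n => killed (trunc n) r w).
Proof.
move=> i j ij; rewrite /killed ler_wpM2r ?alive_ge0// /extend.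
by case: inside => // y; rewrite /trunc le_min ge_min lexx /= ge_min ler_nat ij orbT.
Qed.

Let cvg_killed r (w : Omega) :
  (killed (trunc n) r w)%:E @[n --> \oo] --> (killed f r w)%:E.
Proof.
apply: cvg_near_cst; rewrite /killed /extend; case: inside => [y|]; last exact: nearW.
exists (Num.truncn (f y)).+1 => // n /= yn; congr (_ * _)%:E.
rewrite /trunc min_l//; apply/ltW; apply: lt_le_trans (truncnS_gt _) _.
by rewrite ler_nat.
Qed.

Let cvg_occupation t (w : Omega) :
  occupation (trunc n) 0 t w @[n --> \oo] --> occupation f 0 t w.
Proof.
have -> : occupation f 0 t w =
    \int[lebesgue_measure]_(r in `]0%R, t]) limn (fun n => (killed (trunc n) r w)%:E).
  by apply: eq_integral => r _; apply/esym/cvg_lim => //; exact: cvg_killed.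
apply: cvg_monotone_convergence => //.
- by move=> n; apply/measurable_EFinP; exact: measurable_killed_section.
- by move=> n r _; rewrite lee_fin killed_ge0.
- by move=> r _ i j ij; rewrite lee_fin; exact: nd_killed.
Qed.

Let occupation_trunc_le i (h : Borel M -> R) t (w : Omega) : measurable_fun setT h ->
  (forall y, 0 <= h y)%R ->
  (forall r, killed (trunc i) r w <= killed h r w)%R ->
  occupation (trunc i) 0 t w <= occupation h 0 t w.
Proof.
move=> mh h0 H; apply: ge0_le_integral => //.
- by move=> r _; rewrite lee_fin killed_ge0.
- by apply/measurable_EFinP; exact: measurable_killed_section.
- by apply/measurable_EFinP; exact: measurable_killed_section.
- by move=> r _; rewrite lee_fin.
Qed.

(** Replacing f by min(f,n) decreases d, and the bound depends on f only through d,
    so it passes to the limit by monotone convergence, first in time and then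
    over paths. *)
Lemma khasminskii (s d t : R) x : (0 < s)%R -> (d < 1)%R -> (0 <= t)%R ->
  (forall y, \int[law y]_v occupation f 0 s v <= d%:E) ->
  \int[law x]_w expeR (occupation f 0 t w) <=
    ((1 - d)^-1 * expR (t * (s^-1 * ln ((1 - d)^-1))))%:E.
Proof.
move=> s0 d1 t0 Hd; pose u n (w : Paths) := expeR (occupation (trunc n) 0 t w).
have ndocc (w : Paths) : nondecreasing_seq (fun n => occupation (trunc n) 0 t w).
  by move=> i j ij; apply: occupation_trunc_le => // r; exact: nd_killed.
have mu_ n : measurable_fun setT (u n).
  by apply: (measurableT_comp (@measurable_expeR R)); exact: measurable_occupation.
have u0 n w : 0 <= u n w by exact: expeR_ge0.
have ndu w : nondecreasing_seq (u ^~ w).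
  by move=> i j ij; rewrite lee_expeR; exact: ndocc.
have bound n : \int[law x]_w u n w <=
    ((1 - d)^-1 * expR (t * (s^-1 * ln ((1 - d)^-1))))%:E.
  have truncN y : (trunc n y <= n%:R)%R by rewrite ge_min lexx orbT.
  apply: (khasminskii_growth (mtrunc n) (trunc0 n) truncN) => // y.
  apply: le_trans (Hd y); apply: ge0_le_integral => //.
  - by move=> w _; exact: occupation_ge0.
  - exact: measurable_occupation.
  - exact: measurable_occupation.
  - move=> w _; apply: occupation_trunc_le => // r.
    rewrite /killed ler_wpM2r ?alive_ge0// /extend; case: inside => // z.
    by rewrite ge_min lexx.
apply: (@le_trans _ _ (\int[law x]_w limn (u ^~ w))).
  apply: ge0_le_integral => //.
  - by move=> w _; exact: expeR_ge0.
  - by apply: (measurableT_comp (@measurable_expeR R)); exact: measurable_occupation.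
  - apply: (emeasurable_fun_cvg u) => // w _.
    exact: ereal_nondecreasing_is_cvgn.
  - move=> w _.
    apply: (@expeR_lim R (fun n => occupation (trunc n) 0 t w) _ (ndocc w)).
      by move=> n; exact: occupation_ge0.
    exact: cvg_occupation.
rewrite monotone_convergence//.
apply: lime_le; last exact: nearW.
apply: ereal_nondecreasing_is_cvgn => i j ij; apply: ge0_le_integral => // w _.
exact: ndu.
Qed.

End Truncation.

End MarkovProcess.

(** * Topology of a manifold *)

Section ManifoldTopology.
Variables (R : realType) (n : nat) (M : riemannianManifold R n).

Lemma compact_nbhs_real (r : R) (V : set R) : nbhs r V ->
  exists A : set R, [/\ compact A, nbhs r A & A `<=` V].
Proof.
move=> /nbhs_ballP[e /= e0 eV]; exists `[r - e / 2, r + e / 2]%classic; split.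
- exact: segment_compact.
- apply/nbhs_ballP; exists (e / 2) => /=; first by rewrite divr_gt0.
  move=> s; rewrite /ball /= ltr_distlC in_itv /= => /andP[? ?].
  by apply/andP; split; apply: ltW.
- move=> s /=; rewrite in_itv /= => /andP[? ?]; apply: eV.
  by rewrite /ball /= ltr_distlC; apply/andP; split; lra.
Qed.

Lemma compact_nbhs_row (k : nat) (u : 'rV[R]_k) (V : set 'rV[R]_k) : nbhs u V ->
  exists A : set 'rV[R]_k, [/\ compact A, nbhs u A & A `<=` V].
Proof.
move=> [Q uQ QV].
have /choice[A HA] : forall j, exists A : set R,
    [/\ compact A, nbhs (u ord0 j) A & A `<=` Q ord0 j].
  by move=> j; apply: compact_nbhs_real; exact: uQ.
exists [set v | forall j, A j (v ord0 j)]; split.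
- by apply: rV_compact => j; case: (HA j).
- exists (fun _ j => A j) => [i j|v Av j]; last exact: Av.
  by rewrite ord1; case: (HA j).
- move=> v Av; apply: QV => i j; rewrite ord1.
  by case: (HA j) => _ _; apply; exact: Av.
Qed.

Lemma chart_map_continuous (c : chart R n M) (x : M) : chart_dom c x ->
  {for x, continuous (chart_map c)}.
Proof.
move=> cx; have := continuous_chart_map (c := c).
rewrite continuous_open_subspace; last exact: open_chart_dom.
by apply; exact/mem_set.
Qed.

Lemma chart_inv_continuous (c : chart R n M) (x : M) : chart_dom c x ->
  {for chart_map c x, continuous (chart_inv c)}.
Proof.
move=> cx; have := continuous_chart_inv (c := c).
rewrite continuous_open_subspace; last exact: open_chart_img.
by apply; apply/mem_set; exists x.
Qed.

(** A compact neighbourhood in a chart is carried to M by the inverse chart. *)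
Lemma manifold_locally_compact (x : M) (U : set M) : nbhs x U ->
  exists K : set M, [/\ compact K, nbhs x K & K `<=` U].
Proof.
move=> xU; pose c := chart_at x.
have cx : chart_dom c x := mem_chart_at x.
have : nbhs (chart_map c x) (chart_img c `&` chart_inv c @^-1` U).
  apply: filterI; last by apply: chart_inv_continuous => //; rewrite chart_mapK.
  by apply: open_nbhs_nbhs; split; [exact: open_chart_img|exists x].
move=> /compact_nbhs_row[A [cA nA sA]].
exists (chart_inv c @` A); split.
- apply: continuous_compact cA; apply: continuous_subspaceW (continuous_chart_inv (c := c)).
  by move=> u /sA[].
- have : nbhs x (chart_dom c `&` chart_map c @^-1` A).
    apply: filterI; last exact: chart_map_continuous.
    by apply: open_nbhs_nbhs; split; [exact: open_chart_dom|].
  by apply: filterS => y [cy Ay]; exists (chart_map c y) => //; rewrite chart_mapK.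
- by move=> _ [u /sA[_ Uu] <-].
Qed.

(** By local compactness the members of a countable base that lie in a compact
    subset of U cover U.  V k and K k are the finite unions of these base members,
    and of the compact sets around them, up to index k; base members with no
    such compact set are replaced by the empty set. *)
Lemma manifold_exhaustible (U : set M) : open U -> exhaustible U.
Proof.
move=> oU; have [B cB [oB nB]] := @manifold_second_countable R n M.
have [e Be] := countable_enumeration cB.
have /choice[VK HVK] : forall k, exists VK : set M * set M,
    [/\ open VK.1, compact VK.2, VK.1 `<=` VK.2, VK.2 `<=` U &
        forall K : set M, compact K -> K `<=` U -> B (e k) -> e k `<=` K -> VK.1 = e k].
  move=> k; have [[K [cK KU Bk ekK]]|nK] := pselect (exists K : set M,
      [/\ compact K, K `<=` U, B (e k) & e k `<=` K]).
    by exists (e k, K); split=> //; exact: oB.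
  exists (set0, set0); split=> //=; [exact: open0|exact: compact0|].
  by move=> K cK KU Bk ekK; case: nK; exists K.
exists (fun k => \bigcup_(i in [set i | (i <= k)%N]) (VK i).1),
  (fun k => \big[setU/set0]_(i < k.+1) (VK i).2); split; last first.
  move=> x Ux; have [K [cK xK KU]] : exists K : set M, [/\ compact K, nbhs x K & K `<=` U].
    by apply: manifold_locally_compact; apply: open_nbhs_nbhs.
  have [b [Bb bx] bK] := nB x _ xK; have [k kb] := Be b Bb.
  have [_ _ _ _ Hk] := HVK k.
  by exists k => //; exists k => //=; rewrite (Hk K) ?kb.
split.
- by move=> k; apply: bigcup_open => i _; case: (HVK i).
- by move=> i j ij; apply/subsetPset => x [k /= ki xk]; exists k => //=; exact: leq_trans ij.
- move=> k; elim/big_ind : _ => [|A A' cA cA'|i _]; first exact: compact0.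
    exact: compactU.
  by case: (HVK i).
- move=> k; rewrite -(bigcup_mkord k.+1 (fun i => (VK i).2)) => x [i /= ik xi]; exists i => //=.
  by case: (HVK i) => _ _ + _ _; exact.
- move=> k; rewrite -(bigcup_mkord k.+1 (fun i => (VK i).2)) => x [i _ xi].
  by case: (HVK i) => _ _ _ + _; exact.
Qed.

Lemma continuous_row_mx (T : topologicalType) (k l : nat) (f : T -> 'rV[R]_k)
    (g : T -> 'rV[R]_l) (x : T) : {for x, continuous f} -> {for x, continuous g} ->
  {for x, continuous (fun y => row_mx (f y) (g y))}.
Proof.
move=> cf cg A [Q xQ QA]; rewrite nbhs_simpl /=.
have : \forall y \near x, forall j, Q ord0 j (row_mx (f y) (g y) ord0 j).
  apply: filter_forall => j; have := xQ ord0 j; rewrite mxE.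
  move=> Qj; apply: (@filterS _ (nbhs x) _ [set y | Q ord0 j
    (match fintype.split j with inl i => f y ord0 i | inr i => g y ord0 i end)]).
    by move=> y; rewrite /= mxE.
  move: Qj.
  case: (fintype.split j) => i Qi.
    by have := cvg_comp _ _ cf (@coord_continuous R 1 k ord0 i (f x)); apply.
  by have := cvg_comp _ _ cg (@coord_continuous R 1 l ord0 i (g x)); apply.
apply: filterS => y Qy; apply: QA => i j; rewrite ord1; exact: Qy.
Qed.

(** In charts around f w and g w the kernel is a function F of (t, u, v) in
    Euclidean space; the smoothness condition for the empty list of partial
    derivatives is the continuity of F. *)
Lemma smooth_kernel_continuous (p : R -> M -> M -> R) (T : topologicalType)
    (f g : T -> M) (t : R) (w : T) : smooth_kernel p -> 0 < t ->
  {for w, continuous f} -> {for w, continuous g} ->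
  {for w, continuous (fun v => p t (f v) (g v))}.
Proof.
move=> sp t0 cf cg; pose c := chart_at (f w); pose d := chart_at (g w).
have cfw : chart_dom c (f w) := mem_chart_at (f w).
have dgw : chart_dom d (g w) := mem_chart_at (g w).
pose Z v : 'rV[R]_(1 + (n + n)) :=
  row_mx (t%:M : 'rV[R]_1) (row_mx (chart_map c (f v)) (chart_map d (g v))).
pose F (z : 'rV[R]_(1 + (n + n))) := p (lsubmx z ord0 ord0)
  (chart_inv c (lsubmx (rsubmx z))) (chart_inv d (rsubmx (rsubmx z))).
have FZ v : F (Z v) = p t (chart_inv c (chart_map c (f v))) (chart_inv d (chart_map d (g v))).
  by rewrite /F /Z row_mxKl !row_mxKr row_mxKl mxE mulr1n.
have cZ : {for w, continuous Z}.
  apply: continuous_row_mx; first by move=> A; exact: cvg_cst.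
  apply: continuous_row_mx.
    exact: (cvg_comp _ _ cf (chart_map_continuous cfw)).
  exact: (cvg_comp _ _ cg (chart_map_continuous dgw)).
have cF : {for Z w, continuous F}.
  have [|//] := sp c d (atlas_chart_at _) (atlas_chart_at _) [::] (Z w).
  rewrite /= /Z row_mxKl !row_mxKr row_mxKl mxE mulr1n; split=> //.
    by exists (f w).
  by exists (g w).
have cFZ : {for w, continuous (F \o Z)} by exact: continuous_comp.
have E0 : F (Z w) = p t (f w) (g w) by rewrite FZ !chart_mapK.
have : F (Z v) @[v --> w] --> p t (f w) (g w) by rewrite -E0; exact: cFZ.
apply: cvg_trans; apply: near_eq_cvg.
have nc : \forall v \near w, chart_dom c (f v).
  by apply: cf; apply: open_nbhs_nbhs; split; [exact: open_chart_dom|].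
have nd : \forall v \near w, chart_dom d (g v).
  by apply: cg; apply: open_nbhs_nbhs; split; [exact: open_chart_dom|].
by apply: filterS2 nc nd => v cv dv; rewrite FZ !chart_mapK.
Qed.

End ManifoldTopology.

(** * The heat potential and the exponential bound *)

Section DynkinPotential.
Variables (R : realType) (n : nat) (M : riemannianManifold R n).
Variables (mu : {measure set (Borel M) -> \bar R}) (p : R -> M -> M -> R).
Variable P : M -> probability (Borel (path_space R M)) R.
Notation Omega := (path_space R M).
Notation Paths := (g_sigma_algebraType (@coord_events R M)).
Notation normc := ComplexField.Normc.normc.
Local Open Scope ereal_scope.

Lemma measurable_normc (w : M -> R[i]) : borel_complex w ->
  measurable_fun setT ((fun y => normc (w y)) : Borel M -> R).
Proof.
move=> bw; apply: (measurability _ (RGenInftyO.measurableE R)).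
move=> _ [_ [a ->] <-]; rewrite setTI.
have oU : open ([set z | `|z| < (a%:C)%C]%R : set (R[i] : numFieldType)).
  rewrite openE => z /= za; apply/nbhs_ballP.
  exists ((a%:C)%C - `|z|)%R; first by rewrite /= subr_gt0.
  move=> y; rewrite /ball /= ltrBrDl => zy; apply: le_lt_trans zy.
  by rewrite -{1}[y](subrK z) addrC (le_trans (ler_normD _ _))// distrC.
rewrite (_ : _ @^-1` _ = w @^-1` [set z | `|z| < (a%:C)%C]%R); first exact: bw.
have normE (z : R[i]) : `|z|%R = ((normc z)%:C)%C by [].
by apply/seteqP; split=> y; rewrite /= in_itv /= normE ltcR.
Qed.

Lemma normc_ge0 (z : R[i]) : (0 <= normc z)%R.
Proof. by case: z => a b; exact: sqrtr_ge0. Qed.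

Hypothesis hp : minimal_heat_kernel mu p.
Hypothesis hP : forall x0 : M, wiener_measure mu p x0 (P x0).

Let p0 t x y : (0 < t)%R -> (0 <= p t x y)%R.
Proof. by case: hp => + _ _; exact. Qed.

Let cpx t y : (0 < t)%R -> continuous (fun x => p t x y).
Proof.
case: hp => _ sp _ t0 x; apply: (smooth_kernel_continuous sp t0).
  exact: cvg_id.
by move=> A; exact: cvg_cst.
Qed.

Let cpy t x : (0 < t)%R -> continuous (p t x).
Proof.
case: hp => _ sp _ t0 y; apply: (smooth_kernel_continuous sp t0).
  by move=> A; exact: cvg_cst.
exact: cvg_id.
Qed.

Let hM : hausdorff_space M := @manifold_hausdorff R n M.
Let scM : @second_countable M := @manifold_second_countable R n M.
Let exM (U : set M) : open U -> exhaustible U := @manifold_exhaustible R n M U.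

Variable w : M -> R[i].
Hypothesis bw : borel_complex w.

Notation f := (fun y => normc (w y)).
Notation law := (law P).
Let mf : measurable_fun setT (f : Borel M -> R). Proof. exact: measurable_normc. Qed.
Let f0 y : (0 <= f y)%R. Proof. exact: normc_ge0. Qed.

Lemma integral_path_occupation s (g : Omega) :
  \int[lebesgue_measure]_(r in `[0%R, s]) (absw w (coord_process r g) * alive r g)%:E =
  occupation f 0 s g.
Proof. exact: (occupationE hM exM s g mf). Qed.

Lemma D_occupation s : D P w s = ereal_sup (range (fun x : M => \int[law x]_g occupation f 0 s g)).
Proof.
rewrite /D; apply: (congr1 (fun h : M -> \bar R => ereal_sup (range h))).
apply/funext => x.
under eq_integral do rewrite integral_path_occupation.
rewrite integral_law//.
- exact: (measurable_occupation hM exM).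
- by move=> g; exact: occupation_ge0.
Qed.

Lemma D_ge0 s : 0 <= D P w s.
Proof.
rewrite D_occupation; apply: (@le_trans _ _ (\int[law point]_g occupation f 0 s g)).
  by apply: integral_ge0 => g _; exact: occupation_ge0.
by apply: ereal_sup_ubound; exists (point : M).
Qed.

(** By Fubini E^x[A(0,s)] is the time integral of E^x[f(X_r) 1_{r<zeta}], and
    r < zeta implies that X_r is in M, where X_r has density p(r,x,.). *)
Lemma D_le_potential s : D P w s <= potential mu p w s.
Proof.
rewrite D_occupation; apply: ge_ereal_sup => _ [x _ <-].
apply: (@le_trans _ _ (\int[lebesgue_measure]_(r in `]0%R, s])
    \int[mu]_y (p r x y * f y)%:E)); last by apply: ereal_sup_ubound; exists x.
rewrite (occupation_fubini hM exM (law x) s mf f0 (lexx 0%R)).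
apply: ge0_le_integral_pointwise => r.
  by move=> _; apply: integral_ge0 => g _; rewrite lee_fin killed_ge0.
move=> rs; have /andP[r0 _] : (0 < r <= s)%R by move: rs; rewrite /= in_itv.
have mV : measurable (visits r setT : set Paths) by exact: measurable_visits.
have al : admissible 0 [:: (r, [set: M])] by split=> //; exact: measurableT.
have mEf : measurable_fun setT (fun y : Borel M => (f y)%:E) by exact/measurable_EFinP.
have -> : \int[mu]_y (p r x y * f y)%:E = chain mu p 0 x [:: (r, setT)] (EFin \o f).
  by rewrite /= subr0; apply: eq_integral => y _; rewrite EFinM.
rewrite -(@integral_cylinder R M mu p P scM p0 cpx cpy hP x [::] r setT (EFin \o f))//.
have -> : cylinder (rcons [::] (r, setT)) = visits r setT :> set Omega by exact: setIT.
rewrite [leRHS]integral_mkcond.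
have mg : measurable_fun setT
    ((fun g => (EFin \o f) (place r g)) \_ (visits r setT) : Paths -> \bar R).
  apply/(measurable_restrictT _ _).1 => //; apply: measurable_funTS.
  by apply: (measurableT_comp mEf); exact: measurable_place.
rewrite -(@integral_law R M P x _ mg); last first.
  by move=> g; rewrite patchE; case: ifP => //; rewrite lee_fin.
apply: ge0_le_integral_pointwise => g _.
  by rewrite lee_fin killed_ge0.
rewrite patchE /killed; case: ifPn => rg.
  have [z _ zr] := set_mem rg; rewrite lee_fin /place -zr !extend_embed.
  by rewrite ler_piMr// /alive; case: (_ < _).
have -> : extend 0%R f (coord_process r g) = 0%R; last by rewrite mul0r.
rewrite /extend; case E : inside => [z|//]; exfalso; move/negP : rg; apply.
by apply/mem_set; exists z => //; rewrite (inside_Some E).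
Qed.

(** On t < zeta the factor 1_{r<zeta} equals 1 for all r <= t, so the exponent is
    the occupation integral; elsewhere the integrand vanishes. *)
Lemma sup_exp_moment_le s t : (0 < s)%R -> D P w s < 1 -> (0 <= t)%R ->
  sup_exp_moment P w t <= (1 / (1 - fine (D P w s)) *
     expR (t * (1 / s * ln (1 / (1 - fine (D P w s))))))%:E.
Proof.
move=> s0 D1 t0; rewrite !div1r; set d := fine (D P w s).
have DE : D P w s = d%:E.
  by rewrite fineK// ge0_fin_numE ?D_ge0// (lt_trans D1) ?ltry.
have d1 : (d < 1)%R by rewrite -lte_fin -DE.
have Hd y : \int[law y]_v occupation f 0 s v <= d%:E.
  by rewrite -DE D_occupation; apply: ereal_sup_ubound; exists y.
apply: ge_ereal_sup => _ [x _ <-].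
have mexp : measurable_fun setT (fun g : Paths => expeR (occupation f 0 t g)).
  by apply: (measurableT_comp (@measurable_expeR R)); exact: measurable_occupation.
apply: le_trans (khasminskii hM exM scM p0 cpx cpy hP mf f0 x s0 d1 t0 Hd).
rewrite integral_law//; last by move=> g; exact: expeR_ge0.
apply: ge0_le_integral_pointwise => g _.
  by rewrite mule_ge0 ?expeR_ge0// lee_fin alive_ge0.
rewrite /alive; case: ltP => [tz|_]; last by rewrite mule0 expeR_ge0.
rewrite mule1 -integral_path_occupation lee_expeR le_eqVlt; apply/orP; left; apply/eqP.
apply: eq_integral => r; rewrite inE /= in_itv /= => /andP[r0 rt].
rewrite /alive (_ : (r%:E < explosion_time g) = true) ?mulr1//.
by apply: le_lt_trans tz; rewrite lee_fin.
Qed.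

End DynkinPotential.

Theorem mainTheorem4 (R : realType) (n : nat) (M : riemannianManifold R n)
    (mu : {measure set (Borel M) -> \bar R}) (p : R -> M -> M -> R)
    (P : M -> probability (Borel (path_space R M)) R)
    (hmu : riemannian_volume mu)
    (hp : minimal_heat_kernel mu p)
    (hP : forall x0 : M, wiener_measure mu p x0 (P x0)) :
  (forall w : M -> R[i], contractive_dynkin mu p w ->
     (exists c1 c2 : R, [/\ 0 < c1, 0 < c2 &
        forall t : R, 0 <= t ->
          (sup_exp_moment P w t <= (c1 * expR (t * c2))%:E)%E]) /\
     (forall s : R, 0 < s -> (D P w s < 1)%E ->
        let c1 := 1 / (1 - fine (D P w s)) in
        let c2 := 1 / s * ln (1 / (1 - fine (D P w s))) in
        forall t : R, 0 <= t ->
          (sup_exp_moment P w t <= (c1 * expR (t * c2))%:E)%E)) /\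
  (forall (w : M -> R[i]) (delta : R), kato mu p w -> 1 < delta ->
     (exists2 c : R, 0 < c &
        forall t : R, 0 <= t ->
          (sup_exp_moment P w t <= (delta * expR (t * c))%:E)%E) /\
     (forall s : R, 0 < s -> (D P w s < (1 - 1 / delta)%:E)%E ->
        let c := 1 / s * ln (1 / (1 - fine (D P w s))) in
        forall t : R, 0 <= t ->
          (sup_exp_moment P w t <= (delta * expR (t * c))%:E)%E)).
Proof.
have explicit (w : M -> R[i]) s t : borel_complex w -> 0 < s -> (D P w s < 1)%E -> 0 <= t ->
    (sup_exp_moment P w t <= (1 / (1 - fine (D P w s)) *
      expR (t * (1 / s * ln (1 / (1 - fine (D P w s))))))%:E)%E.
  by move=> bw; exact: (sup_exp_moment_le hp hP bw).
have fine_lt (w : M -> R[i]) s (a : R) : borel_complex w ->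
    (D P w s < a%:E)%E -> fine (D P w s) < a.
  move=> bw Da; rewrite -lte_fin fineK// ge0_fin_numE; last exact: D_ge0 bw s.
  by rewrite (lt_trans Da) ?ltry.
(* The explicit rate (1/s) log(1/(1-D)) is 0 when D = 0; adding 1 makes it
   positive. *)
have exp_weaken : forall a t c : R, 0 <= a -> 0 <= t ->
    a * expR (t * c) <= a * expR (t * `|c| + t).
  move=> a t c a0 t0; rewrite ler_wpM2l// ler_expR (le_trans (ler_wpM2l t0 (ler_norm c)))//.
  by rewrite lerDl.
have bound_delta (w : M -> R[i]) s (delta t : R) : borel_complex w -> 1 < delta ->
    0 < s -> (D P w s < (1 - 1 / delta)%:E)%E -> 0 <= t ->
    (sup_exp_moment P w t <=
      (delta * expR (t * (1 / s * ln (1 / (1 - fine (D P w s))))))%:E)%E.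
  move=> bw d1 s0 Ds t0; have d0 : 0 < delta by exact: lt_trans d1.
  have D1 : (D P w s < 1)%E.
    by apply: lt_trans Ds _; rewrite lte_fin gtrBl divr_gt0.
  apply: le_trans (explicit w s t bw s0 D1 t0) _; rewrite lee_fin ler_wpM2r ?expR_ge0//.
  have := fine_lt _ _ _ bw Ds; rewrite ltrBrDl -ltrBrDr => /ltW dd.
  rewrite ler_pdivrMr; last by rewrite subr_gt0; exact: fine_lt bw D1.
  by rewrite -ler_pdivrMl// mulrC.
split=> [w [bw [s s0 ps]]|w delta [bw kw] d1]; split.
- have D1 : (D P w s < 1)%E by exact: le_lt_trans (D_le_potential hp hP bw s) ps.
  have F1 : 0 < 1 - fine (D P w s) by rewrite subr_gt0; exact: fine_lt bw D1.
  exists (1 / (1 - fine (D P w s))),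
    (`|1 / s * ln (1 / (1 - fine (D P w s)))| + 1); split.
  + by rewrite divr_gt0.
  + by rewrite ltr_wpDl.
  + move=> t t0; apply: le_trans (explicit w s t bw s0 D1 t0) _.
    by rewrite lee_fin mulrDr mulr1 exp_weaken// ltW// divr_gt0.
- by move=> s' s'0 D1 c1 c2 t t0; exact: explicit.
- have [s s0 ps] : exists2 s, 0 < s & (potential mu p w s < (1 - 1 / delta)%:E)%E.
    have e0 : (0 < (1 - 1 / delta)%:E)%E.
      by rewrite lte_fin subr_gt0 ltr_pdivrMr ?mul1r// (lt_trans _ d1).
    have near_small : \forall t \near 0^'+, (potential mu p w t < (1 - 1 / delta)%:E)%E.
      by apply: (kw [set y | (y < (1 - 1 / delta)%:E)%E]); apply: open_nbhs_nbhs;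
        split => //; exact: open_ereal_lt_ereal.
    near (0 : R)^'+ => s; exists s.
      by near: s; exact: nbhs_right_gt.
    by near: s.
  have Ds := le_lt_trans (D_le_potential hp hP bw s) ps.
  exists (`|1 / s * ln (1 / (1 - fine (D P w s)))| + 1); first by rewrite ltr_wpDl.
  move=> t t0; apply: le_trans (bound_delta w s delta t bw d1 s0 Ds t0) _.
  by rewrite lee_fin mulrDr mulr1 exp_weaken// ltW// (lt_trans _ d1).
- by move=> s s0 Ds c t t0; exact: bound_delta.
Unshelve. all: by end_near. Qed.
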